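(* Let $I\subset\mathbb{R}[x_1,\dots,x_n]$ be an ideal and $w\in\mathbb{R}^n$. If $p\in\mathcal{V}_{\mathbb{R}}(\operatorname{in}_w(I))$ is nonsingular, then there exist $c_0\in\mathbb{R}_{>0}$ and a family $\{x_c\}_{c\in(c_0,\infty)}\subset\mathbb{R}^n$ such that $c^w\cdot x_c\in\mathcal{V}_{\mathbb{R}}(I)$ for all $c\in(c_0,\infty)$ and $x_c\to p$ as $c\to\infty$.
   Context: Initial forms: for $w\in\mathbb{R}^n$ and a nonzero polynomial $f=\sum_a f_a x^a$, $\deg_w(f)=\max\{w^Ta : f_a\ne0\}$ and $\operatorname{in}_w(f)=\sum_{a:\,w^Ta=\deg_w(f)}f_a x^a$; $\operatorname{in}_w(0)=0$. For an ideal $I$, $\operatorname{in}_w(I)=\langle \operatorname{in}_w(f): f\in I\rangle$. $\mathcal{V}_{\mathbb{R}}(J)=\{p\in\mathbb{R}^n : f(p)=0\ \forall f\in J\}$. For $c>0$, $c^w\cdot x=(c^{w_1}x_1,\dots,c^{w_n}x_n)$. Nonsingular: a point $p\in\mathcal{V}_{\mathbb{R}}(J)$ is nonsingular with respect to the (possibly non-radical) ideal $J$ if the localization of $\mathbb{R}[x_1,\dots,x_n]/J$ at the maximal ideal of $p$ is a regular local ring; equivalently, for generators $q_1,\dots,q_r$ of $J$, the Jacobian matrix $(\partial q_i/\partial x_j(p))$ has rank $n-d$, where $d$ is the Krull dimension of that local ring. Here this is applied with $J=\operatorname{in}_w(I)$. *)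

(* Defs.v *)
From HB Require Import structures.
From mathcomp Require Import all_boot all_order all_algebra.
From mathcomp Require Import generic_quotient ring_quotient.
From mathcomp Require Import ring.
From mathcomp Require Import all_classical all_reals all_analysis.
(* Only the notations of mpoly clash with those of MathComp-Analysis. *)
From mathcomp Require Import -(notations) mpoly.

Set Implicit Arguments.
Unset Strict Implicit.
Unset Printing Implicit Defensive.

Import Order.TTheory GRing.Theory Num.Theory.
Import numFieldNormedType.Exports.

Local Open Scope classical_set_scope.
Local Open Scope ring_scope.
Local Open Scope quotient_scope.

Notation "{ 'mpoly' T [ n ] }" := (mpoly n T)
  (at level 0, T, n at level 2, format "{ 'mpoly'  T [ n ] }") : type_scope.

(* Unlike the [idealr] of ring_quotient, an [ideal] need not be proper, since
   both I and in_w(I) may be the unit ideal. *)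
Record ideal (A : comPzRingType) := Ideal {
  ideal_set :> set A;
  ideal_has0 : ideal_set 0;
  idealD : forall x y, ideal_set x -> ideal_set y -> ideal_set (x + y);
  idealMl : forall a x, ideal_set x -> ideal_set (a * x)
}.

Section IdealTheory.
Variable A : comPzRingType.
Implicit Types (G : set A) (K P M : ideal A).

Definition ideal_gen_set G : set A :=
  [set x | forall K, G `<=` K -> ideal_set K x].

Lemma ideal_gen_has0 G : ideal_gen_set G 0.
Proof. by move=> K _; exact: ideal_has0. Qed.

Lemma ideal_genD G x y :
  ideal_gen_set G x -> ideal_gen_set G y -> ideal_gen_set G (x + y).
Proof. by move=> Gx Gy K GK; apply: idealD; [exact: Gx|exact: Gy]. Qed.

Lemma ideal_genMl G a x : ideal_gen_set G x -> ideal_gen_set G (a * x).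
Proof. by move=> Gx K GK; apply: idealMl; exact: Gx. Qed.

Definition ideal_gen G : ideal A :=
  Ideal (@ideal_gen_has0 G) (@ideal_genD G) (@ideal_genMl G).

Definition prime_ideal P : Prop :=
  ~ ideal_set P 1 /\
  forall x y, ideal_set P (x * y) -> ideal_set P x \/ ideal_set P y.

Definition maximal_ideal M : Prop :=
  ~ ideal_set M 1 /\
  forall K, M `<=` K -> ~ ideal_set K 1 -> K `<=` M.

Definition generated_by K (s : seq A) : Prop :=
  ideal_gen [set` s] = K :> set A.

Definition min_generators K (d : nat) : Prop :=
  (exists2 s, size s = d & generated_by K s) /\
  (forall s, generated_by K s -> (d <= size s)%N).

End IdealTheory.

Definition noetherian (A : comPzRingType) : Prop :=
  forall K : ideal A, exists s, generated_by K s.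

Definition unique_maximal (A : comPzRingType) (m : ideal A) : Prop :=
  maximal_ideal m /\ forall M : ideal A, maximal_ideal M -> M = m :> set A.

Definition prime_chain (A : comPzRingType) (k : nat) : Prop :=
  exists P : nat -> ideal A,
    (forall i, (i <= k)%N -> prime_ideal (P i)) /\
    (forall i, (i < k)%N -> P i `<` P i.+1).

Definition krull_dim (A : comPzRingType) (d : nat) : Prop :=
  prime_chain A d /\ forall k, prime_chain A k -> (k <= d)%N.

Definition regular_local_ring (A : comPzRingType) : Prop :=
  noetherian A /\
  exists m : ideal A, unique_maximal m /\
    exists d : nat, krull_dim A d /\ min_generators m d.

Section QuotientRing.
Variables (A : comPzRingType) (J : ideal A).

Definition ideal_pred : {pred A} := fun x => `[< ideal_set J x >].

Lemma ideal_pred_zmod : zmod_closed ideal_pred.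
Proof.
split=> [|x y /asboolP Jx /asboolP Jy]; apply/asboolP; first exact: ideal_has0.
by rewrite -mulN1r; apply: idealD => //; exact: idealMl.
Qed.

HB.instance Definition _ := GRing.isZmodClosed.Build A ideal_pred
  ideal_pred_zmod.

(* The library puts a ring structure on quotients by proper ideals only; the
   multiplication below completes its quotient of additive groups. *)
Definition quot_ring := @Quotient.quot A ideal_pred.

HB.instance Definition _ := GRing.Zmodule.on quot_ring.
HB.instance Definition _ := Quotient.on quot_ring.

Definition quot_pi (x : A) : quot_ring := \pi_(@Quotient.quot A ideal_pred) x.

Lemma quot_piE x y : quot_pi x = quot_pi y <-> ideal_set J (x - y).
Proof.
split=> [/eqP|Jxy]; last apply/eqP; rewrite /quot_pi.
  by rewrite -Quotient.idealrBE => /asboolP.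
by rewrite -Quotient.idealrBE; apply/asboolP.
Qed.

Lemma quot_piK (x : quot_ring) : quot_pi (repr x) = x.
Proof. exact: reprK. Qed.

Lemma quot_piD x y : quot_pi (x + y) = quot_pi x + quot_pi y.
Proof. by rewrite /quot_pi [LHS]Quotient.pi_add. Qed.

Definition quot_one : quot_ring := quot_pi 1.
Definition quot_mul (x y : quot_ring) : quot_ring := quot_pi (repr x * repr y).

Lemma quot_piM x y : quot_pi (x * y) = quot_mul (quot_pi x) (quot_pi y).
Proof.
apply/quot_piE.
have Jr z : ideal_set J (z - repr (quot_pi z)) by apply/quot_piE; rewrite quot_piK.
set x' := repr _; set y' := repr _.
have -> : x * y - x' * y' = y * (x - x') + x' * (y - y') by ring.
by apply: idealD; apply: idealMl; exact: Jr.
Qed.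

Lemma quot_mulA : associative quot_mul.
Proof.
move=> x y z; rewrite -[x]quot_piK -[y]quot_piK -[z]quot_piK.
by rewrite -!quot_piM mulrA.
Qed.

Lemma quot_mulC : commutative quot_mul.
Proof. by move=> x y; rewrite /quot_mul mulrC. Qed.

Lemma quot_mul1 : left_id quot_one quot_mul.
Proof. by move=> x; rewrite -[x]quot_piK -quot_piM mul1r. Qed.

Lemma quot_mulDl : left_distributive quot_mul +%R.
Proof.
move=> x y z; rewrite -[x]quot_piK -[y]quot_piK -[z]quot_piK.
by rewrite -quot_piD -!quot_piM -quot_piD mulrDl.
Qed.

HB.instance Definition _ := GRing.Zmodule_isComPzRing.Build quot_ring
  quot_mulA quot_mulC quot_mul1 quot_mulDl.

End QuotientRing.

Record mulset (A : comPzRingType) := MulSet {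
  mulset_set :> set A;
  mulset1 : mulset_set 1;
  mulsetM : forall x y, mulset_set x -> mulset_set y -> mulset_set (x * y)
}.

Section Localization.
Variables (A : comPzRingType) (S : mulset A).

Definition denom := {s : A | `[< mulset_set S s >]}.
Definition denomP (s : denom) : mulset_set S (sval s) := asboolW (valP s).
Definition mk_denom (s : A) (Ss : mulset_set S s) : denom := exist _ s (asboolT Ss).
Definition denom1 : denom := mk_denom (mulset1 S).
Definition denomM (s t : denom) : denom :=
  mk_denom (mulsetM (denomP s) (denomP t)).

Definition fracs := (A * denom)%type.
HB.instance Definition _ := Choice.on fracs.

Definition frac_eqv (x y : fracs) : bool :=
  `[< exists2 u : A, mulset_set S u &
      u * (x.1 * sval y.2) = u * (y.1 * sval x.2) >].

Lemma frac_eqv_class : equiv_class_of frac_eqv.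
Proof.
split=> [x|x y|y x z].
- by apply/asboolP; exists 1 => //; exact: mulset1.
- by apply/asboolP/asboolP => -[u Su e]; exists u.
- move=> /asboolP[u Su e] /asboolP[v Sv f]; apply/asboolP.
  exists (sval y.2 * (u * v)).
    by apply: mulsetM; [exact: denomP|exact: mulsetM].
  transitivity (v * sval z.2 * (u * (x.1 * sval y.2))); first by ring.
  rewrite e; transitivity (u * sval x.2 * (v * (y.1 * sval z.2))); first by ring.
  by rewrite f; ring.
Qed.

Canonical frac_eqv_equiv := EquivRelPack frac_eqv_class.
Canonical frac_eqv_encModRel := defaultEncModRel frac_eqv.

Definition localization := {eq_quot frac_eqv}.
HB.instance Definition _ := Choice.on localization.

Definition frac (a : A) (s : denom) : localization :=
  \pi_({eq_quot frac_eqv}) ((a, s) : fracs).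

Lemma fracE a s b t :
  frac a s = frac b t <->
  exists2 u : A, mulset_set S u & u * (a * sval t) = u * (b * sval s).
Proof.
rewrite /frac; split=> [/eqP|h]; first by rewrite eqmodE => /asboolP.
by apply/eqP; rewrite eqmodE; apply/asboolP.
Qed.

Definition loc_num (x : localization) : A := (repr x).1.
Definition loc_den (x : localization) : denom := (repr x).2.

Lemma loc_fracK x : frac (loc_num x) (loc_den x) = x.
Proof. by rewrite /frac /loc_num /loc_den -surjective_pairing; exact: reprK. Qed.

Definition loc_zero := frac 0 denom1.
Definition loc_one := frac 1 denom1.
Definition loc_opp x := frac (- loc_num x) (loc_den x).
Definition loc_add x y :=
  frac (loc_num x * sval (loc_den y) + loc_num y * sval (loc_den x))
       (denomM (loc_den x) (loc_den y)).
Definition loc_mul x y :=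
  frac (loc_num x * loc_num y) (denomM (loc_den x) (loc_den y)).

Lemma loc_reprE a s : exists2 u : A, mulset_set S u &
  u * (loc_num (frac a s) * sval s) = u * (a * sval (loc_den (frac a s))).
Proof. by apply/fracE; rewrite loc_fracK. Qed.

Lemma loc_oppE a s : loc_opp (frac a s) = frac (- a) s.
Proof.
rewrite /loc_opp; have [u Su e] := loc_reprE a s.
by apply/fracE; exists u => //; rewrite !mulNr !mulrN e.
Qed.

Lemma loc_addE a s b t : loc_add (frac a s) (frac b t) =
  frac (a * sval t + b * sval s) (denomM s t).
Proof.
rewrite /loc_add.
have [u Su e] := loc_reprE a s; have [v Sv f] := loc_reprE b t.
move: (loc_num (frac a s)) (loc_den (frac a s)) e => a' s' e.
move: (loc_num (frac b t)) (loc_den (frac b t)) f => b' t' f.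
apply/fracE; exists (u * v); first exact: mulsetM.
rewrite /=.
transitivity (v * sval t * sval t' * (u * (a' * sval s))
  + u * sval s * sval s' * (v * (b' * sval t))); first by ring.
by rewrite e f; ring.
Qed.

Lemma loc_mulE a s b t :
  loc_mul (frac a s) (frac b t) = frac (a * b) (denomM s t).
Proof.
rewrite /loc_mul.
have [u Su e] := loc_reprE a s; have [v Sv f] := loc_reprE b t.
move: (loc_num (frac a s)) (loc_den (frac a s)) e => a' s' e.
move: (loc_num (frac b t)) (loc_den (frac b t)) f => b' t' f.
apply/fracE; exists (u * v); first exact: mulsetM.
rewrite /=.
transitivity ((u * (a' * sval s)) * (v * (b' * sval t))); first by ring.
by rewrite e f; ring.
Qed.

Lemma frac_eq a s b t : a * sval t = b * sval s -> frac a s = frac b t.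
Proof.
by move=> e; apply/fracE; exists 1; [exact: mulset1|rewrite e].
Qed.

Lemma loc_addA : associative loc_add.
Proof.
move=> x y z; rewrite -[x]loc_fracK -[y]loc_fracK -[z]loc_fracK !loc_addE.
by apply: frac_eq => /=; ring.
Qed.

Lemma loc_addC : commutative loc_add.
Proof.
move=> x y; rewrite -[x]loc_fracK -[y]loc_fracK !loc_addE.
by apply: frac_eq => /=; ring.
Qed.

Lemma loc_add0 : left_id loc_zero loc_add.
Proof.
move=> x; rewrite -[x]loc_fracK loc_addE.
by apply: frac_eq => /=; ring.
Qed.

Lemma loc_addN : left_inverse loc_zero loc_opp loc_add.
Proof.
move=> x; rewrite -[x]loc_fracK loc_oppE loc_addE.
by apply: frac_eq => /=; ring.
Qed.

HB.instance Definition _ := GRing.isZmodule.Build localization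
  loc_addA loc_addC loc_add0 loc_addN.

Lemma loc_mulA : associative loc_mul.
Proof.
move=> x y z; rewrite -[x]loc_fracK -[y]loc_fracK -[z]loc_fracK !loc_mulE.
by apply: frac_eq => /=; ring.
Qed.

Lemma loc_mulC : commutative loc_mul.
Proof.
move=> x y; rewrite -[x]loc_fracK -[y]loc_fracK !loc_mulE.
by apply: frac_eq => /=; ring.
Qed.

Lemma loc_mul1 : left_id loc_one loc_mul.
Proof.
move=> x; rewrite -[x]loc_fracK loc_mulE.
by apply: frac_eq => /=; ring.
Qed.

Lemma loc_mulDl : left_distributive loc_mul loc_add.
Proof.
move=> x y z; rewrite -[x]loc_fracK -[y]loc_fracK -[z]loc_fracK.
rewrite !(loc_mulE, loc_addE).
by apply: frac_eq => /=; ring.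
Qed.

HB.instance Definition _ := GRing.Zmodule_isComPzRing.Build localization
  loc_mulA loc_mulC loc_mul1 loc_mulDl.

End Localization.

Section InitialIdeals.
Variables (R : realType) (n : nat).
Implicit Types (w p : 'rV[R]_n) (f : {mpoly R[n]}) (I J : ideal {mpoly R[n]}).

Definition eval_at p f : R := meval (fun i => p ord0 i) f.

Definition wdot w (a : multinom n) : R := \sum_(i < n) w ord0 i * (a i)%:R.

(* For f != 0 the leading monomial of f lies in the support of f, so that the
   initial value of the iterated maximum does not affect it. *)
Definition deg_w w f : R :=
  \big[Num.max/wdot w (mlead f)]_(a <- msupp f) wdot w a.

Lemma deg_w_ub w f a : a \in msupp f -> wdot w a <= deg_w w f.
Proof.
rewrite /deg_w; elim: (msupp f) => // b s IH.
by rewrite inE big_cons le_max => /orP[/eqP->|/IH ->]; rewrite ?lexx ?orbT.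
Qed.

Lemma deg_w_attained w f :
  f != 0 -> exists2 a, a \in msupp f & wdot w a = deg_w w f.
Proof.
move=> f0; rewrite /deg_w big_seq.
elim/big_ind: _ => [|x y [a fa <-] [b fb <-]|a fa].
- by exists (mlead f) => //; exact: mlead_supp.
- by case: (leP (wdot w a) (wdot w b)) => _; [exists b|exists a].
- by exists a.
Qed.

Definition in_w w f : {mpoly R[n]} :=
  \sum_(a <- msupp f | wdot w a == deg_w w f) mcoeff a f *: mpolyX R a.

Definition in_ideal w I : ideal {mpoly R[n]} :=
  ideal_gen [set in_w w f | f in (I : set {mpoly R[n]})].

Definition real_variety J : set 'rV[R]_n :=
  [set p | forall f, ideal_set J f -> eval_at p f = 0].

Definition scale_w w (c : R) (x : 'rV[R]_n) : 'rV[R]_n :=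
  \row_i (c `^ w ord0 i * x ord0 i).

(* When p is a zero of J, this is the complement of the maximal ideal of p in
   the coordinate ring R[x]/J. *)
Definition nonvanishing_set J p : set (quot_ring J) :=
  [set quot_pi J f | f in [set f | eval_at p f <> 0]].

Lemma nonvanishing1 J p : nonvanishing_set p (1 : quot_ring J).
Proof.
by exists 1 => //=; rewrite /eval_at meval1; apply/eqP; exact: oner_neq0.
Qed.

Lemma nonvanishingM J p (x y : quot_ring J) : nonvanishing_set p x ->
  nonvanishing_set p y -> nonvanishing_set p (x * y).
Proof.
move=> [f /= /eqP fp <-] [g /= /eqP gp <-]; exists (f * g).
  by rewrite /eval_at /= mevalM; apply/eqP; exact: mulf_neq0.
exact: quot_piM.
Qed.

Definition nonvanishing J p : mulset (quot_ring J) :=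
  MulSet (nonvanishing1 J p) (@nonvanishingM J p).

Definition local_ring_at J p : comPzRingType := localization (nonvanishing J p).

Definition nonsingular J p : Prop :=
  regular_local_ring (local_ring_at J p).

End InitialIdeals.

(* Main.v *)
Require Import Defs.
From HB Require Import structures.
From mathcomp Require Import all_boot all_order all_algebra.
From mathcomp Require Import all_classical all_reals all_analysis.
From mathcomp Require Import -(notations) mpoly.
From mathcomp Require Import generic_quotient ring lra zify.

Set Implicit Arguments.
Unset Strict Implicit.
Unset Printing Implicit Defensive.

Import Order.TTheory GRing.Theory Num.Theory.
Import numFieldNormedType.Exports.

Local Open Scope classical_set_scope.
Local Open Scope ring_scope.

(** Let [J] be the initial ideal.  Regularity of the local ring of [J] at [p]
    provides a chain of primes of length [d] above [J] inside the maximal ideal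
    of [p], and [F_1, .., F_k] in [I] with [n <= d + k] whose initial forms
    [q_i] have independent gradients at [p].  If [J] were not contained in
    [(q)] locally, the Hilbert function [N |-> dim R[x] / (J + m_p^N)] would
    grow slower than [N^d], against the chain of primes; hence [h * J] lies in
    [(q)] for some [h] with [h(p) <> 0], and [h] may be taken w-homogeneous.

    A finite basis [g_j] of [I] representing every [f] in [I] as a combination
    of weight at most [deg_w f] exists by Dickson's lemma.  The same statement
    with all weights [-1] is the Artin-Rees lemma, which gives the prime chain
    bound and Krull's intersection theorem.  Comparing initial forms yields
    [h g_j = sum_i c_ji F_i + sum_j' b_jj' g_j'] where the last sum has smaller
    weight.

    The rescaled [F_i] are small perturbations of the [q_i] near [p], so a
    contraction argument produces common zeros [x_c -> p].  At these points the
    displayed identity is a linear system in the rescaled values of the [g_j]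
    with dominant diagonal [h(x_c)], so all the [g_j] vanish there. *)

(** * Dickson's lemma *)

(** Induction on the size of [F], the coordinates in which members of [S] may differ. For a fixed
    [a] in [S], an [x] not above [a] has [phi x i < phi a i] for some [i] in [F], so it lies in one
    of finitely many slices [phi x i = v], where one coordinate fewer varies. *)
Lemma dickson_on (T : finType) (X : eqType) (phi : X -> T -> nat)
    (F : {set T}) (S : set X) :
  (forall x y, S x -> S y -> forall i, i \notin F -> phi x i = phi y i) ->
  exists s : seq X, (forall x, x \in s -> S x) /\
    forall x, S x -> exists2 y, y \in s & forall i, (phi y i <= phi x i)%N.
Proof.
have [k] := ubnP #|F|; elim: k => // k IH in F S *; rewrite ltnS => Fk agree.
have [[a Sa]|S0] := pselect (exists a, S a); last first.
  by exists [::]; split=> // x Sx; case: S0; exists x.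
have sliceP iv : exists s : seq X, iv.1 \in F ->
    (forall x, x \in s -> S x) /\
    forall x, S x /\ phi x iv.1 = iv.2 ->
      exists2 y, y \in s & forall i, (phi y i <= phi x i)%N.
  have [iF|] := boolP (iv.1 \in F); last by exists [::].
  have [||s [sS sP]] := IH (F :\ iv.1) [set x | S x /\ phi x iv.1 = iv.2].
  - by apply: leq_trans Fk; rewrite [ltnRHS](cardsD1 iv.1) iF.
  - move=> x y [Sx xv] [Sy yv] i; rewrite !inE negb_and negbK.
    by case/orP=> [/eqP->|/agree]; [rewrite xv yv|apply].
  by exists s => _; split=> // x /sS [].
have [b bP] := choice sliceP.
exists (a :: flatten [seq [seq z | v <- iota 0 (phi a i), z <- b (i, v)]
                        | i <- enum F]); split=> [x|x Sx].
  rewrite inE => /orP[/eqP->//|/flattenP[_ /mapP[i iF ->]]].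
  move=> /allpairsPdep[v [z [_ zb ->]]]; rewrite mem_enum in iF.
  by have [+ _] := bP (i, v) iF; apply.
have [le_ax|] := boolP [forall i, (phi a i <= phi x i)%N].
  by exists a; [exact: mem_head|exact/forallP].
rewrite negb_forall => /existsP[i]; rewrite -ltnNge => ltxa.
have iF : i \in F.
  by apply: contraLR ltxa => iNF; rewrite (agree _ _ Sx Sa) // ltnn.
have [_ /(_ x)[//|y yb yx]] := bP (i, phi x i) iF; exists y => //.
rewrite inE; apply/orP; right; apply/flattenP; eexists.
  by apply/mapP; exists i; rewrite ?mem_enum.
by apply/allpairsPdep; exists (phi x i), y; rewrite mem_iota.
Qed.

Lemma dickson (T : finType) (X : eqType) (phi : X -> T -> nat) (S : set X) :
  exists s : seq X, (forall x, x \in s -> S x) /\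
    forall x, S x -> exists2 y, y \in s & forall i, (phi y i <= phi x i)%N.
Proof. by apply: (@dickson_on _ _ _ (finset.setTfor T)) => x y _ _ i; rewrite inE. Qed.

(** * Division with control of the weights *)

Section StrongBasis.
Variables (R : realType) (n : nat).
Implicit Types (w : 'rV[R]_n) (a b : multinom n) (f g : {mpoly R[n]}).

Lemma wdotD w a b : wdot w (mnm_add a b) = wdot w a + wdot w b.
Proof.
rewrite /wdot -big_split; apply: eq_bigr => i _ /=.
by rewrite mnmDE natrD mulrDr.
Qed.

(** A total order compatible with addition of exponents and refining the weight. With negative
    weights it need not be a well-order, so induction along it requires a degree bound. *)
Definition wlem w a b :=
  (wdot w a < wdot w b) || (wdot w a == wdot w b) && (a <= b)%O.

Lemma wlem_refl w a : wlem w a a.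
Proof. by rewrite /wlem eqxx lexx orbT. Qed.

Lemma wlem_total w a b : wlem w a b || wlem w b a.
Proof. by rewrite /wlem; case: ltgtP => //= _; exact: le_total. Qed.

Lemma wlem_trans w : transitive (wlem w).
Proof.
move=> b a c /orP[ab|/andP[/eqP ab leab]] /orP[bc|/andP[/eqP bc lebc]].
- by rewrite /wlem (lt_trans ab bc).
- by rewrite /wlem -bc ab.
- by rewrite /wlem ab bc.
- by rewrite /wlem ab bc eqxx (le_trans leab lebc) orbT.
Qed.

Lemma wlem_anti w a b : wlem w a b -> wlem w b a -> a = b.
Proof.
rewrite /wlem; case: ltgtP => //= _ ab ba.
by apply/eqP; rewrite eq_le ab ba.
Qed.

Lemma wlem_add2r w c a b :
  wlem w (mnm_add a c) (mnm_add b c) = wlem w a b.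
Proof. by rewrite /wlem !wdotD ltrD2r (inj_eq (addIr _)) lemc_add2l. Qed.

Lemma wlem_wdot w a b : wlem w a b -> wdot w a <= wdot w b.
Proof. by case/orP=> [/ltW //|/andP[/eqP-> //]]. Qed.

Definition wlead w f a :=
  a \in msupp f /\ forall b, b \in msupp f -> wlem w b a.

Lemma wlead_exists w f : f != 0 -> exists a, wlead w f a.
Proof.
rewrite -msupp_eq0 /wlead; elim: (msupp f) => // a s IH _.
case: s IH => [_|b s IH].
  by exists a; split=> [|b]; rewrite inE // => /eqP->; exact: wlem_refl.
have [//|c [cs cP]] := IH.
have [ac|ca] := orP (wlem_total w a c).
  exists c; split=> [|d]; rewrite inE ?cs ?orbT // => /orP[/eqP->//|].
  exact: cP.
exists a; split=> [|d]; rewrite inE ?eqxx // => /orP[/eqP->|/cP dc].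
  exact: wlem_refl.
exact: wlem_trans dc ca.
Qed.

(** For [f = 0] this holds for every [B], unlike [deg_w w f <= B], because [deg_w w 0] is a default
    value. *)
Definition wbound w (B : R) f := forall a, a \in msupp f -> wdot w a <= B.

Lemma wleadE w f a : wlead w f a -> deg_w w f = wdot w a.
Proof.
move=> [af aP]; apply/eqP; rewrite eq_le deg_w_ub // andbT.
have [|b bf <-] := @deg_w_attained R n w f; last exact/wlem_wdot/aP.
by apply/eqP => f0; move: af; rewrite f0 msupp0.
Qed.

(* The exponents of [f] are homogenized to total degree [D] by the slack
   coordinate [D - mdeg a]; this makes the division terminate even though
   the weights may be negative. *)
Lemma strong_basis w (I : ideal {mpoly R[n]}) :
  exists (m : nat) (g : 'I_m -> {mpoly R[n]}),
    (forall i, ideal_set I (g i) /\ g i != 0) /\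
    forall f, ideal_set I f -> exists b : 'I_m -> {mpoly R[n]},
      f = \sum_i b i * g i /\
      forall B, wbound w B f -> forall i a, a \in msupp (b i) ->
        wdot w a + deg_w w (g i) <= B.
Proof.
pose X := ({mpoly R[n]} * nat * multinom n)%type.
pose phi (x : X) (o : option 'I_n) : nat :=
  if o is Some i then x.2 i else (x.1.2 - mdeg x.2)%N.
pose bnd f D := forall a, a \in msupp f -> (mdeg a <= D)%N.
pose S : set X :=
  [set x | [/\ ideal_set I x.1.1, bnd x.1.1 x.1.2 & wlead w x.1.1 x.2]].
have [s [sS sP]] := dickson phi S.
pose x0 : X := (0, 0%N, mnm0).
pose g (i : 'I_(size s)) := (nth x0 s i).1.1.
have gS (i : 'I_(size s)) : S (nth x0 s i) by apply/sS/mem_nth.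
exists (size s), g; split=> [i|].
  have [Ig _ [ag _]] := gS i; split=> //.
  by apply/eqP => g0; move: ag; rewrite -/(g i) g0 msupp0.
(* The termination measure: among the finitely many monomials of degree at most [D], those
   [wlem]-below [a]. A division step lowers its bound over the support. *)
pose cnt D a := #|[pred b : bmultinom n D.+1 | wlem w (bmnm b) a]|.
suff key : forall D k f, ideal_set I f -> bnd f D ->
    (forall a, a \in msupp f -> (cnt D a <= k)%N) ->
    exists b : 'I_(size s) -> {mpoly R[n]}, f = \sum_i b i * g i /\
      forall B, wbound w B f -> forall i a, a \in msupp (b i) ->
        wdot w a + deg_w w (g i) <= B.
  move=> f If; apply: (key (msize f) (\max_(a <- msupp f) cnt (msize f) a)%N) => //.
    by move=> a af; rewrite ltnW // msize_mdeg_lt.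
  by move=> a af; exact: (leq_bigmax_seq (F := cnt (msize f))).
have cntS a b D : (mdeg a <= D)%N -> (mdeg b <= D)%N ->
    wlem w a b -> a != b -> (cnt D a < cnt D b)%N.
  move=> aD bD ab neq; apply/proper_card/fintype.properP; split.
    by apply/fintype.subsetP=> c; rewrite !inE => /wlem_trans; apply.
  have bD' : (mdeg b < D.+1)%N by [].
  exists (BMultinom bD'); rewrite !inE ?wlem_refl //=.
  by apply: contra neq => ba; exact/eqP/(wlem_anti ab).
move=> D; elim=> [|k IH] f If fD fk.
  suff -> : f = 0.
    exists (fun=> 0); split; first by rewrite big1 // => i _; rewrite mul0r.
    by move=> B _ i a; rewrite msupp0.
  apply/eqP; rewrite -msupp_eq0; move: fD fk; rewrite /bnd.
  case: (msupp f) => // a l fD fk.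
  have aD : (mdeg a < D.+1)%N by apply: fD; exact: mem_head.
  have := fk a (mem_head _ _); rewrite leqn0 => /eqP/card0_eq.
  by move/(_ (BMultinom aD)); rewrite !inE wlem_refl.
have [->|f0] := eqVneq f 0.
  exists (fun=> 0); split; first by rewrite big1 // => i _; rewrite mul0r.
  by move=> B _ i a; rewrite msupp0.
have [a fa] := wlead_exists w f0; have [af aP] := fa.
have [|y ys yle] := sP (f, D, a); first by [].
have [j jE] : exists j : 'I_(size s), nth x0 s j = y.
  move: ys; rewrite -index_mem => h; exists (Ordinal h).
  by rewrite nth_index // -index_mem.
have [Ig gD [bg bP]] := gS j; move: Ig gD bg bP; rewrite -/(g j) jE.
set b := y.2; set D' := y.1.2 => Ig gD bg bP.
have ba : lem b a by apply/mnm_lepP => i; exact: (yle (Some i)).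
pose e := mnm_sub a b; have eb : mnm_add e b = a by exact: submK.
(* The slack coordinate gives [D' - mdeg b <= D - mdeg a], so the multiple of [g j] to be subtracted
   stays within degree [D]. *)
have eD : (mdeg e + D' <= D)%N.
  have := yle None; rewrite /= -/D' -/b; have := gD _ bg.
  have := fD _ af; rewrite -eb mdegD; lia.
pose cf := mcoeff a f / mcoeff b (g j).
have gb0 : mcoeff b (g j) != 0 by rewrite -mcoeff_msupp.
pose f' := f - (cf *: mpolyX R e) * g j.
have suppm c : c \in msupp ((cf *: mpolyX R e) * g j) ->
    exists2 d, d \in msupp (g j) & c = mnm_add d e.
  rewrite -scalerAl => /msuppZ_le; rewrite mulrC (perm_mem (msuppMX _ _)).
  by case/mapP=> d dg ->; exists d; rewrite // addmC.
have f'P c : c \in msupp f' -> wlem w c a /\ c != a /\ (mdeg c <= D)%N.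
  move=> cf'; split; last split.
  - move: cf' => /msuppB_le; rewrite mem_cat => /orP[/aP//|/suppm[d /bP db ->]].
    by rewrite -eb [mnm_add e b]addmC wlem_add2r.
  - apply: contraL cf' => /eqP->; rewrite -mcoeff_eq0 mcoeffB -scalerAl mcoeffZ.
    by rewrite mulrC -eb mulrC [_ * g j]mulrC mcoeffMX eb /cf mulfVK // subrr.
  - move: cf' => /msuppB_le; rewrite mem_cat => /orP[/fD//|/suppm[d /gD db ->]].
    by rewrite mdegD; move: eD db; lia.
have [|||b' [f'E b'P]] := IH f'.
- by rewrite /f' -mulNr; apply: idealD => //; exact: idealMl.
- by move=> c /f'P[_ []].
- move=> c /f'P[ca [neq cD]]; rewrite -ltnS.
  exact: leq_trans (cntS _ _ _ cD (fD _ af) ca neq) (fk _ af).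
exists (fun i => b' i + (if i == j then cf *: mpolyX R e else 0)); split.
  under eq_bigr do rewrite mulrDl.
  rewrite big_split /= -f'E (bigD1 j) //= eqxx big1 ?addr0 ?subrK //.
  by move=> i /negPf->; rewrite mul0r.
move=> B fB i c; have f'B : wbound w B f'.
  by move=> d /f'P[/wlem_wdot da _]; exact: le_trans da (fB _ af).
case: eqP => [->|_]; last by rewrite addr0; exact: b'P.
move/msuppD_le; rewrite mem_cat => /orP[|/msuppZ_le]; first exact: b'P.
rewrite msuppX inE => /eqP->; rewrite (@wleadE w (g j) b) //.
by rewrite -wdotD eb; exact: fB.
Qed.

End StrongBasis.

(** * Codimension of subspaces *)

Section Codimension.
Variables (F : fieldType) (V : lmodType F).
Implicit Types (W : set V).

Definition subspace W :=
  W 0 /\ forall (c : F) x y, W x -> W y -> W (c *: x + y).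

Lemma subspaceZ W c x : subspace W -> W x -> W (c *: x).
Proof. by move=> [W0 WD] Wx; rewrite -[_ *: _]addr0; exact: WD. Qed.

Lemma subspaceD W x y : subspace W -> W x -> W y -> W (x + y).
Proof. by move=> [_ WD] Wx Wy; rewrite -[x]scale1r; exact: WD. Qed.

Lemma subspace_sum W (T : Type) (r : seq T) (P : pred T) (f : T -> V) :
  subspace W -> (forall i, P i -> W (f i)) -> W (\sum_(i <- r | P i) f i).
Proof.
by move=> sW Wf; elim/big_ind: _ => //; [case: sW|move=> x y; exact: subspaceD].
Qed.

Definition indep_mod W (T : finType) (s : T -> V) :=
  forall c : T -> F, W (\sum_i c i *: s i) -> forall i, c i = 0.

Definition spans_mod W (T : finType) (s : T -> V) :=
  forall v, exists c : T -> F, W (v - \sum_i c i *: s i).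

(** Stands for [dim (V / W) >= k] without forming the quotient or assuming it finite-dimensional. *)
Definition codim_ge W (k : nat) :=
  exists (T : finType) (s : T -> V), (k <= #|T|)%N /\ indep_mod W s.

Lemma codim_ge0 W : codim_ge W 0.
Proof. by exists void, (fun=> 0); split=> // c _ []. Qed.

Lemma codim_geS W W' k : W `<=` W' -> codim_ge W' k -> codim_ge W k.
Proof.
by move=> WW' [T [s [kT sP]]]; exists T, s; split=> // c /WW'; exact: sP.
Qed.

(** Writing the [s i] through the [t j] modulo [W] gives a matrix; if it had more rows than columns,
    a non-zero vector of its left kernel would be a relation between the [s i] modulo [W]. *)
Lemma codim_ge_leq W k (T : finType) (t : T -> V) :
  subspace W -> codim_ge W k -> spans_mod W t -> (k <= #|T|)%N.
Proof.
move=> sW [U [s [kU sP]]] tP; apply: leq_trans kU _; rewrite leqNgt.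
apply/negP => ltTU; have [C CP] := choice (fun i => tP (s i)).
pose M := \matrix_(i < #|U|, j < #|T|) C (enum_val i) (enum_val j).
have : kermx M != 0.
  rewrite -mxrank_eq0 mxrank_ker subn_eq0 -ltnNge.
  exact: leq_ltn_trans (rank_leq_col M) ltTU.
case/rowV0Pn=> v /sub_kermxP vM /eqP[]; apply/rowP => i; rewrite mxE.
have <- : v 0 (enum_rank (enum_val i)) = v 0 i by rewrite enum_valK.
apply: (sP (fun u => v 0 (enum_rank u))).
have -> : \sum_u v 0 (enum_rank u) *: s u =
    \sum_u v 0 (enum_rank u) *: (s u - \sum_j C u j *: t j).
  under [RHS]eq_bigr do rewrite scalerBr scaler_sumr.
  rewrite sumrB [X in _ - X](_ : _ = 0) ?subr0 // exchange_big big1 // => j _.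
  under eq_bigr do rewrite scalerA.
  rewrite -scaler_suml (reindex (@enum_val U predT)) /=; last first.
    by exists enum_rank => u _; [exact: enum_valK|exact: enum_rankK].
  have /rowP/(_ (enum_rank j)) := vM; rewrite !mxE => e0.
  rewrite [X in X *: _](_ : _ = 0) ?scale0r // -[RHS]e0.
  by apply: eq_bigr => u _; rewrite !mxE enum_valK enum_rankK.
by apply: subspace_sum => // u _; apply: subspaceZ.
Qed.

End Codimension.

(** * Powers of the maximal ideal of 0, and growth along a chain of primes *)

Section Order.
Variables (R : realType) (n : nat).
Implicit Types (f g : {mpoly R[n]}) (I J P : ideal {mpoly R[n]}) (N : nat).

(* [ord_ge N] is membership in the [N]-th power of the maximal ideal of 0. *)
Definition ord_ge N f := forall a, a \in msupp f -> (N <= mdeg a)%N.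

Lemma ord_geW N M f : (M <= N)%N -> ord_ge N f -> ord_ge M f.
Proof. by move=> MN fN a /fN; exact: leq_trans. Qed.

Lemma ord_ge0 N : ord_ge N (0 : {mpoly R[n]}).
Proof. by move=> a; rewrite msupp0. Qed.

Lemma ord_geD N f g : ord_ge N f -> ord_ge N g -> ord_ge N (f + g).
Proof.
by move=> fN gN a /msuppD_le; rewrite mem_cat => /orP[/fN|/gN].
Qed.

Lemma ord_geZ N c f : ord_ge N f -> ord_ge N (c *: f).
Proof. by move=> fN a /msuppZ_le /fN. Qed.

Lemma ord_geM N M f g : ord_ge N f -> ord_ge M g -> ord_ge (N + M) (f * g).
Proof.
move=> fN gM a /msuppM_le /allpairsP[[b c] [/= /fN bN /gM cM ->]].
by rewrite mdegD leq_add.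
Qed.

Lemma ord_geMl N f g : ord_ge N g -> ord_ge N (f * g).
Proof. by move=> gN; rewrite -[N]add0n; exact: ord_geM. Qed.

Lemma ord_ge_sum N (T : Type) (r : seq T) (Q : pred T) (F : T -> {mpoly R[n]}) :
  (forall i, Q i -> ord_ge N (F i)) -> ord_ge N (\sum_(i <- r | Q i) F i).
Proof.
by move=> h; elim/big_ind: _ => // [|f g]; [exact: ord_ge0|exact: ord_geD].
Qed.

Lemma ord_geX a : ord_ge (mdeg a) (mpolyX R a).
Proof. by move=> b; rewrite msuppX inE => /eqP->. Qed.

Lemma ord_ge1P f : ord_ge 1 f <-> mcoeff mnm0 f = 0.
Proof.
split=> [f1|f0 a]; last first.
  by rewrite lt0n mdeg_eq0; apply: contraL => /eqP->; rewrite mcoeff_msupp f0 eqxx.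
by apply/eqP; rewrite mcoeff_eq0; apply/negP => /f1; rewrite mdeg0.
Qed.

Lemma ord_ge2P f : mcoeff mnm0 f = 0 -> (forall i, mcoeff (mnm1 i) f = 0) ->
  ord_ge 2 f.
Proof.
move=> f0 f1 a; apply: contraLR; rewrite -ltnNge ltnS leq_eqVlt ltnS leqn0.
case/orP=> [/mdeg1P[i /eqP->]|]; first by rewrite -mcoeff_eq0 f1.
by rewrite mdeg_eq0 => /eqP->; rewrite -mcoeff_eq0 f0.
Qed.

Lemma idealZ I c f : ideal_set I f -> ideal_set I (c *: f).
Proof. by move=> If; rewrite -mul_mpolyC; exact: idealMl. Qed.

Lemma idealB I f g : ideal_set I f -> ideal_set I g -> ideal_set I (f - g).
Proof. by move=> If Ig; rewrite -scaleN1r; apply: idealD => //; exact: idealZ. Qed.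

Lemma ideal_sum I (T : Type) (r : seq T) (Q : pred T) (F : T -> {mpoly R[n]}) :
  (forall i, Q i -> ideal_set I (F i)) -> ideal_set I (\sum_(i <- r | Q i) F i).
Proof.
by move=> h; elim/big_ind: _ => // [|f g]; [exact: ideal_has0|exact: idealD].
Qed.

(** The ideal [I + m^N], where [m] is the maximal ideal of 0. Its codimension as a function of [N]
    is the Hilbert function that is bounded from both sides below. *)
Definition plus_ord I N : set {mpoly R[n]} :=
  [set f | exists2 g, ideal_set I g & ord_ge N (f - g)].

Lemma plus_ordD I N f g :
  plus_ord I N f -> plus_ord I N g -> plus_ord I N (f + g).
Proof.
move=> [u Iu fu] [v Iv gv]; exists (u + v); first exact: idealD.
by rewrite opprD addrACA; exact: ord_geD.
Qed.

Lemma plus_ordMl I N f g : plus_ord I N g -> plus_ord I N (f * g).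
Proof.
move=> [v Iv gv]; exists (f * v); first exact: idealMl.
by rewrite -mulrBr; exact: ord_geMl.
Qed.

Lemma plus_ord_ideal I N f : ideal_set I f -> plus_ord I N f.
Proof. by exists f; rewrite ?subrr //; exact: ord_ge0. Qed.

Lemma plus_ord_ord I N f : ord_ge N f -> plus_ord I N f.
Proof. by exists 0; rewrite ?subr0 //; exact: ideal_has0. Qed.

Lemma plus_ordS I J N M : I `<=` J -> (M <= N)%N ->
  plus_ord I N `<=` plus_ord J M.
Proof.
by move=> IJ MN f [g Ig fg]; exists g; [exact: IJ|exact: ord_geW fg].
Qed.

Lemma plus_ord_subspace I N : subspace (plus_ord I N).
Proof.
split=> [|c f g If Ig]; first by apply: plus_ord_ideal; exact: ideal_has0.
by apply: plus_ordD => //; rewrite -mul_mpolyC; exact: plus_ordMl.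
Qed.

(* Artin-Rees for the maximal ideal of 0, from the strong basis for the weight
   (-1, .., -1). *)
Lemma artin_rees I : exists (m : nat) (g : 'I_m -> {mpoly R[n]}) (c : nat),
  (forall i, ideal_set I (g i)) /\
  forall N f, ideal_set I f -> ord_ge N f -> exists b : 'I_m -> {mpoly R[n]},
    f = \sum_i b i * g i /\ forall i, ord_ge (N - c) (b i).
Proof.
pose w : 'rV[R]_n := const_mx (-1).
have wE a : wdot w a = - (mdeg a)%:R.
  rewrite /wdot mdegE natr_sum -sumrN; apply: eq_bigr => i _.
  by rewrite mxE mulN1r.
have [m [g [gI gP]]] := strong_basis w I.
(* For these weights [- deg_w w (g i)] is the order of [g i], and the degree of any of its
   monomials, here the leading one, bounds it from above. *)
pose c := (\max_i mdeg (mlead (g i)))%N.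
exists m, g, c; split=> [i|N f If fN]; first by case: (gI i).
have [b [fE bP]] := gP f If; exists b; split=> // i a ab.
have fB : wbound w (- N%:R) f by move=> d /fN; rewrite wE lerN2 ler_nat.
have := bP _ fB i a ab.
have : - (c%:R) <= deg_w w (g i).
  apply: (@le_trans _ _ (wdot w (mlead (g i)))).
    rewrite wE lerN2 ler_nat /c.
    exact: (leq_bigmax_cond (F := fun i => mdeg (mlead (g i)))).
  by apply: deg_w_ub; apply: mlead_supp; case: (gI i).
rewrite wE => h1 h2; have : - (mdeg a)%:R - c%:R <= - N%:R :> R by lra.
rewrite -opprD lerN2 -natrD ler_nat => h; lia.
Qed.

Section Colon.
Variables (P : ideal {mpoly R[n]}) (x : {mpoly R[n]}).

Let Px : set {mpoly R[n]} := [set f | exists u t, ideal_set P u /\ f = u + x * t].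

Let Px0 : Px 0.
Proof. by exists 0, 0; rewrite mulr0 addr0; split=> //; exact: ideal_has0. Qed.

Let PxD f g : Px f -> Px g -> Px (f + g).
Proof.
move=> [u [t [Pu ->]]] [v [s [Pv ->]]]; exists (u + v), (t + s).
by split; [exact: idealD|ring].
Qed.

Let PxM a f : Px f -> Px (a * f).
Proof.
move=> [u [t [Pu ->]]]; exists (a * u), (a * t).
by split; [exact: idealMl|ring].
Qed.

(** Artin-Rees for [P + (x)]: if [x f - u] has order [N] with [u] in [P], it is a combination of
    generators [U i + x * T i] with coefficients [b i] of order [N - c]. Then
    [x * (f - \sum_i b i * T i)] lies in [P], and primality removes [x]. *)
Lemma colon_plus_ord : prime_ideal P -> ~ ideal_set P x ->
  exists c, forall N f, plus_ord P N (x * f) -> plus_ord P (N - c) f.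
Proof.
move=> [_ Pp] Px'; have [m [g [c [gP ar]]]] := artin_rees (Ideal Px0 PxD PxM).
exists c => N f [u Pu ordr].
have [|b [rE bP]] := ar _ _ _ ordr.
  exists (- u), f; split; last by rewrite addrC.
  by rewrite -sub0r; apply: idealB => //; exact: ideal_has0.
have [U UP] := choice gP; have [T TP] := choice UP.
exists (f - \sum_i b i * T i); last first.
  by rewrite subKr; apply: ord_ge_sum => i _; rewrite mulrC; exact: ord_geMl.
have : ideal_set P (x * (f - \sum_i b i * T i)).
  have -> : x * (f - \sum_i b i * T i) = u + \sum_i b i * U i.
    rewrite mulrBr -[x * f](subrK u) rE [_ + u]addrC -addrA; congr (_ + _).
    rewrite mulr_sumr -sumrB; apply: eq_bigr => i _.
    by rewrite (TP i).2; ring.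
  apply: idealD => //; apply: ideal_sum => i _; apply: idealMl.
  by case: (TP i).
by case/Pp.
Qed.

End Colon.

(** Take [x] in [P1] but not in [P0], and join the family for [P1] with [x] times the family for
    [P0]. Modulo [P1] a relation involves the first family only; what remains is divisible by [x],
    and [colon_plus_ord] cancels [x] at the cost of [c] orders. *)
Lemma codim_ge_prime_step (P0 P1 : ideal {mpoly R[n]}) : prime_ideal P0 ->
  P0 `<` P1 ->
  exists c, forall N a b, codim_ge (plus_ord P1 N) a ->
    codim_ge (plus_ord P0 (N - c)) b -> codim_ge (plus_ord P0 N) (a + b).
Proof.
move=> pP0 [P01 P10].
have [x [P1x P0x]] : exists x, ideal_set P1 x /\ ~ ideal_set P0 x.
  apply/not_existsP => h; apply: P10 => x P1x.
  by apply: contrapT => P0x; apply: (h x).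
have [c cP] := colon_plus_ord pP0 P0x.
exists c => N a b [T [s [aT sP]]] [U [t [bU tP]]].
exists (T + U)%type, (fun z => match z with inl i => s i | inr j => x * t j end).
split; first by rewrite card_sum leq_add.
move=> k; rewrite big_sumType /=.
under [X in _ + X]eq_bigr do rewrite scalerAr.
rewrite -mulr_sumr => h.
have k0 i : k (inl i) = 0.
  apply: (sP (fun i => k (inl i))); set S := \sum_i _.
  have -> : S = S + x * (\sum_i k (inr i) *: t i) -
      x * (\sum_i k (inr i) *: t i) by rewrite addrK.
  rewrite -mulNr [- x * _]mulrC mulrN; apply: plus_ordD.
    exact: plus_ordS (leqnn _) _ h.
  by apply: plus_ord_ideal; rewrite -mulNr; apply: idealMl.
case=> // j; apply: (tP (fun j => k (inr j))); apply: cP.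
move: h; rewrite big1 ?add0r // => i _.
by rewrite k0 scale0r.
Qed.

(** The Hilbert function grows at least like the power [d]: each prime added below the chain allows
    [M] uses of the previous step, each contributing [M ^ d] independent elements. *)
Lemma codim_ge_prime_chain d (P : nat -> ideal {mpoly R[n]}) :
  (forall i, (i <= d)%N -> prime_ideal (P i)) ->
  (forall i, (i < d)%N -> P i `<` P i.+1) ->
  (forall f, ideal_set (P d) f -> mcoeff mnm0 f = 0) ->
  exists C, forall M, (0 < M)%N -> codim_ge (plus_ord (P 0%N) (C * M)) (M ^ d).
Proof.
elim: d => [|d IH] in P *; move=> Pp Plt Pm.
  exists 1%N => M M0; rewrite mul1n expn0.
  exists unit, (fun=> 1); split; first by rewrite card_unit.
  move=> c [g Pg]; rewrite (bigD1 tt) //= big1 ?addr0; last by case.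
  move=> h [].
  have /ord_ge1P := ord_geW M0 h.
  by rewrite mcoeffB mcoeffZ mcoeff1 eqxx mulr1 Pm // subr0.
have [|||C CP] := IH (fun i => P i.+1).
- by move=> i id; exact: Pp.
- by move=> i id; exact: Plt.
- exact: Pm.
have [c cP] := codim_ge_prime_step (Pp 0%N isT) (Plt 0%N isT).
(* Order [C * M] serves the chain from [P 1], and each of the [M] steps costs [c] more. *)
exists (C + c)%N => M M0.
suff h j : codim_ge (plus_ord (P 0%N) (C * M + c * j)) (j * M ^ d).
  by rewrite mulnDl expnS.
elim: j => [|j IHj]; first exact: codim_ge0.
rewrite mulSn; apply: cP.
  apply: codim_geS (CP M M0); apply: plus_ordS => //; lia.
apply: codim_geS IHj; apply: plus_ordS => //; lia.
Qed.

End Order.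

(** * Local generation of [J] by [q] at the origin *)

Section RegularAtOrigin.
Variables (R : realType) (n k e : nat).
Variables (J : ideal {mpoly R[n]}) (q : 'I_k -> {mpoly R[n]}).
Variable (y : 'I_e -> {mpoly R[n]}).
Hypothesis Jq : forall i, ideal_set J (q i).
Hypothesis y1 : forall j, ord_ge 1 (y j).
Hypothesis cotangent : forall i : 'I_n, exists (al : 'I_e -> R) (be : 'I_k -> R),
  ord_ge 2 (mpolyX R (mnm1 i) - \sum_j al j *: y j - \sum_j be j *: q j).
Implicit Types (f g : {mpoly R[n]}) (G H : {mpoly R[e]}) (N : nat).

Definition in_q f := exists c : 'I_k -> {mpoly R[n]}, f = \sum_i c i * q i.

Lemma in_q0 : in_q 0.
Proof. by exists (fun=> 0); rewrite big1 // => i _; rewrite mul0r. Qed.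

Lemma in_qD f g : in_q f -> in_q g -> in_q (f + g).
Proof.
move=> [c ->] [c' ->]; exists (fun i => c i + c' i); rewrite -big_split.
by apply: eq_bigr => i _; rewrite mulrDl.
Qed.

Lemma in_qM f g : in_q g -> in_q (f * g).
Proof.
move=> [c ->]; exists (fun i => f * c i); rewrite mulr_sumr.
by apply: eq_bigr => i _; rewrite mulrA.
Qed.

Lemma in_q_gen i : in_q (q i).
Proof.
exists (fun j => (j == i)%:R); rewrite (bigD1 i) //= eqxx mul1r big1 ?addr0 //.
by move=> j /negPf->; rewrite mul0r.
Qed.

Let Q := Ideal in_q0 in_qD in_qM.

Lemma in_q_sub : Q `<=` J.
Proof. by move=> f [c ->]; apply: ideal_sum => i _; exact: idealMl. Qed.

Let ev G : {mpoly R[n]} := mmap (@mpolyC n R) y G.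

Let evE G : ev G = \sum_(a <- msupp G) mcoeff a G *: mmap1 y a.
Proof. by apply: eq_bigr => a _; rewrite mul_mpolyC. Qed.

Lemma mmap1_ord a : ord_ge (mdeg a) (mmap1 y a).
Proof.
rewrite /mmap1 mdegE; elim/big_rec2: _ => [|i N f _ fN]; first by [].
apply: ord_geM => //; elim: (a i) => [|j IH]; first by [].
by rewrite exprS -add1n; apply: ord_geM.
Qed.

Let ev_ord G s : (forall a, a \in msupp G -> mdeg a = s) -> ord_ge s (ev G).
Proof.
move=> Gs; rewrite evE big_seq; apply: ord_ge_sum => a /Gs <-.
by apply: ord_geZ; exact: mmap1_ord.
Qed.

(** Modulo [(q)] and higher order, [f] is a form of degree [s] in the [y j]: this describes the
    graded ring of [R[x] / (q)] at 0 as a quotient of a polynomial ring in [e] variables. *)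
Definition is_form s f := exists2 G : {mpoly R[e]},
  (forall a, a \in msupp G -> mdeg a = s) & plus_ord Q s.+1 (f - ev G).

Lemma is_formD s f g : is_form s f -> is_form s g -> is_form s (f + g).
Proof.
move=> [G Gs fG] [H Hs gH]; exists (G + H).
  by move=> a /msuppD_le; rewrite mem_cat => /orP[/Gs|/Hs].
by rewrite /ev mmapD opprD addrACA; exact: plus_ordD.
Qed.

Lemma is_formZ s c f : is_form s f -> is_form s (c *: f).
Proof.
move=> [G Gs fG]; exists (c *: G); first by move=> a /msuppZ_le /Gs.
by rewrite /ev mmapZ mul_mpolyC -scalerBr -mul_mpolyC; exact: plus_ordMl.
Qed.

Lemma is_form_ord s f : ord_ge s.+1 f -> is_form s f.
Proof.
move=> fs; exists 0; first by move=> a; rewrite msupp0.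
by rewrite /ev mmap0 subr0; exact: plus_ord_ord.
Qed.

Lemma is_formM s f g : is_form s f -> ord_ge 1 g -> is_form 1 g ->
  is_form s.+1 (f * g).
Proof.
move=> [G Gs fG] g1 [H Hs gH]; exists (G * H).
  move=> a /msuppM_le /allpairsP[[b c] [/= /Gs bs /Hs cs ->]].
  by rewrite mdegD bs cs addn1.
rewrite /ev (rmorphM (mmap (@mpolyC n R) y)) -/(ev G) -/(ev H).
have -> : f * g - ev G * ev H = (f - ev G) * g + ev G * (g - ev H) by ring.
apply: plus_ordD.
  case: fG => u Qu fu; exists (u * g).
    by rewrite mulrC; exact: (@idealMl _ Q).
  by rewrite -mulrBl -addn1; exact: ord_geM.
case: gH => u Qu gu; exists (ev G * u); first exact: (@idealMl _ Q).
by rewrite -mulrBr -addn2; apply: ord_geM => //; exact: ev_ord.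
Qed.

Lemma is_form_var i : is_form 1 (mpolyX R (mnm1 i)).
Proof.
have [al [be h]] := cotangent i.
exists (\sum_j al j *: mpolyX R (mnm1 j)).
  move=> a /msupp_sum_le /flattenP[s /mapP[j _ ->]] /msuppZ_le.
  by rewrite msuppX inE => /eqP->; rewrite mdeg1.
rewrite /ev (raddf_sum (mmap (@mpolyC n R) y)) /=.
under eq_bigr do rewrite mmapZ mmapX mmap1U mul_mpolyC.
exists (\sum_j be j *: q j); last exact: h.
exists (fun j => mpolyC n (be j)).
by apply: eq_bigr => j _; rewrite mul_mpolyC.
Qed.

Lemma is_form_mon a : is_form (mdeg a) (mpolyX R a).
Proof.
have [s] := ubnP (mdeg a); elim: s => // s IH in a *; rewrite ltnS => as_.
have [a0|a0] := posnP (mdeg a).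
  move/eqP: (a0); rewrite mdeg_eq0 => /eqP ->; rewrite mdeg0 mpolyX0.
  exists 1; last first.
    by rewrite /ev rmorph1 subrr; apply: plus_ord_ideal; exact: in_q0.
  by move=> b; rewrite -mpolyC1 msupp1 inE => /eqP->; rewrite mdeg0.
have [i ai] : exists i, a i != 0%N.
  apply/existsP; apply: contraTT a0; rewrite negb_exists => /forallP a0.
  by rewrite -eqn0Ngt mdegE big1 // => i _; apply/eqP; rewrite -[_ == _]negbK a0.
have aE : mnm_add (mnm_sub a (mnm1 i)) (mnm1 i) = a.
  by apply: submK; rewrite lep1mP.
have dE : mdeg a = (mdeg (mnm_sub a (mnm1 i))).+1.
  by rewrite -[in LHS]aE mdegD mdeg1 addn1.
rewrite dE -[in mpolyX R a]aE mpolyXD; apply: is_formM.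
- by apply: IH; rewrite -dE.
- by rewrite -(mdeg1 i); exact: ord_geX.
- exact: is_form_var.
Qed.

(** The monomials of degree [s] are products of variables, each of which is a linear form in the
    [y j] by [cotangent]; the other monomials are of higher order. *)
Lemma is_formP s f : ord_ge s f -> is_form s f.
Proof.
move=> fs; rewrite [f]mpolyE big_seq.
elim/big_ind: _ => [|g h|a af].
- exact/is_form_ord/ord_ge0.
- exact: is_formD.
- apply: is_formZ; have := fs a af; rewrite leq_eqVlt => /orP[/eqP->|].
    exact: is_form_mon.
  by move=> sa; apply: is_form_ord; apply: ord_geW sa _; exact: ord_geX.
Qed.

Section UpperBound.
Variables (r : nat) (G : {mpoly R[e]}).
Hypothesis G0 : G != 0.
Hypothesis Gr : forall a, a \in msupp G -> mdeg a = r.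
Hypothesis JG : plus_ord J r.+1 (ev G).

Let a0 := mlead G.
(** Indexes the monomials of degree below [N] not divisible by [a0]: some coordinate has exponent
    below [a0 i <= r], and the [e - 1] others are below [N]. Repetitions do no harm in a spanning
    family. *)
Let T N : finType := ('I_e * 'I_r.+1 * {ffun 'I_e.-1 -> 'I_N})%type.
Let mon N (t : T N) : multinom e := Multinom [tuple
  if unlift t.1.1 j is Some j' then nat_of_ord (t.2 j') else nat_of_ord t.1.2
  | j < e].

Let monP N a : (mdeg a < N)%N -> ~~ lem a0 a -> exists t : T N, mon t = a.
Proof.
move=> aN; rewrite /lem negb_forall => /existsP[i]; rewrite -ltnNge => ai.
have a0r : (a0 i <= r)%N.
  rewrite -(Gr (mlead_supp G0)) mdegE (bigD1 i) //=; exact: leq_addr.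
have air : (a i < r.+1)%N by rewrite ltnS; apply: leq_trans (ltnW ai) a0r.
have ajN j : (a j < N)%N.
  by apply: leq_ltn_trans aN; rewrite mdegE (bigD1 j) //= leq_addr.
exists (i, Ordinal air, [ffun j => Ordinal (ajN (lift i j))]).
apply/mnmP => j; rewrite multinomE tnth_mktuple /=.
by case: unliftP => [j' ->|->] //; rewrite ffunE.
Qed.

Let reducible N f :=
  exists c : T N -> R, plus_ord J N (f - \sum_t c t *: mmap1 y (mon t)).

Let redD N c f g : reducible N f -> reducible N g -> reducible N (c *: f + g).
Proof.
move=> [u fu] [v gv]; exists (fun t => c * u t + v t).
under eq_bigr do rewrite scalerDl -scalerA.
rewrite big_split -scaler_sumr /= opprD addrACA -scalerBr.
by have [_] := plus_ord_subspace J N; apply.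
Qed.

Let red_in N f : plus_ord J N f -> reducible N f.
Proof. by exists (fun=> 0); rewrite big1 ?subr0 // => t _; rewrite scale0r. Qed.

Let red0 N : reducible N 0.
Proof. by apply: red_in; apply: plus_ord_ord; exact: ord_ge0. Qed.

Let red_subspace N : subspace (reducible N).
Proof. by split=> [|c f g]; [exact: red0|exact: redD]. Qed.

Let red_mon N a : ~~ lem a0 a -> reducible N (mmap1 y a).
Proof.
move=> aa0; have [Na|aN] := leqP N (mdeg a).
  apply: red_in; apply: plus_ord_ord; apply: ord_geW Na _; exact: mmap1_ord.
have [t tE] := monP aN aa0; exists (fun u => (u == t)%:R).
rewrite (bigD1 t) //= eqxx scale1r tE big1 ?addr0 ?subrr; last first.
  by move=> u /negPf->; rewrite scale0r.
by apply: plus_ord_ord; exact: ord_ge0.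
Qed.

(** Descending induction on the order of [f], whose lowest part is a form in [y]. A monomial
    divisible by [a0] is rewritten with [G], up to [J] and higher order, into smaller monomials of
    the same degree; an inner induction on the monomial order handles these. *)
Let red_all N f : reducible N f.
Proof.
suff: forall j f, ord_ge (N - j) f -> reducible N f.
  by move=> /(_ N); rewrite subnn; apply.
elim=> [|j IH] {}f fN; first by apply/red_in/plus_ord_ord; rewrite subn0 in fN.
have [jN|Nj] := ltnP j N; last by apply: IH; apply: ord_geW fN; lia.
pose s := (N - j.+1)%N; have sE : (N - j)%N = s.+1 by rewrite /s; lia.
rewrite -/s in fN; rewrite sE in IH.
have red_plus g : plus_ord J s.+1 g -> reducible N g.
  move=> [u Ju gu]; rewrite -[g](subrK u); apply: subspaceD => //.
    exact: IH.
  exact/red_in/plus_ord_ideal.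
have [H Hs fH] := is_formP fN; rewrite -[f](subrK (ev H)).
apply: subspaceD => //.
  by apply: red_plus; exact: (plus_ordS in_q_sub (leqnn _)) fH.
rewrite evE big_seq; apply: subspace_sum => // a /Hs {fH Hs}as_.
apply: subspaceZ => //; elim/(@ltmwf e): a as_ => a IHa as_.
have [a0a|] := boolP (lem a0 a); last exact: red_mon.
pose d := mnm_sub a a0; have aE : mnm_add d a0 = a by exact: submK.
have dE : (mdeg d + r = s)%N by rewrite -as_ -aE mdegD (Gr (mlead_supp G0)).
have mmap1D b c : mmap1 y (mnm_add b c) = mmap1 y b * mmap1 y c.
  by rewrite -!(mmapX y (@mpolyC n R)) mpolyXD rmorphM.
have lc0 : mcoeff a0 G != 0 by rewrite -mcoeff_msupp mlead_supp.
have -> : mmap1 y a = (mcoeff a0 G)^-1 *: (mmap1 y d * ev G -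
    \sum_(b <- msupp G | b != a0) mcoeff b G *: mmap1 y (mnm_add d b)).
  rewrite evE (bigD1_seq a0) ?mlead_supp ?msupp_uniq //= mulrDr mulr_sumr.
  rewrite [X in _ + X - _](_ : _ = \sum_(b <- msupp G | b != a0)
    mcoeff b G *: mmap1 y (mnm_add d b)) ?addrK; last first.
    by apply: eq_bigr => b _; rewrite mmap1D scalerAr.
  by rewrite -scalerAr scalerA mulVf // scale1r -mmap1D aE.
apply: subspaceZ => //; rewrite -scaleN1r; apply: subspaceD => //.
  apply: red_plus; case: JG => u Ju gu; exists (mmap1 y d * u).
    exact: idealMl.
  by rewrite -mulrBr -dE -addnS; apply: ord_geM => //; exact: mmap1_ord.
apply: subspaceZ => //; rewrite big_seq_cond; apply: subspace_sum => //.
move=> b /andP[bG ba0]; apply: subspaceZ => //; apply: IHa.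
  by rewrite -aE ltmc_add2r lt_neqAle ba0 msupp_le_mlead.
by rewrite mdegD (Gr bG).
Qed.

Lemma codim_upper_bound N m : codim_ge (plus_ord J N) m ->
  (m <= e * r.+1 * N ^ e.-1)%N.
Proof.
move=> /(codim_ge_leq (plus_ord_subspace J N)) => /(_ _ _ (@red_all N)).
by rewrite !card_prod card_ffun !card_ord.
Qed.

End UpperBound.

(** Otherwise some [u] in [J] lies in [Q + m^r] but not in [Q + m^(r+1)]. Its form [G] of degree [r]
    in [y] is non-zero with [G(y)] in [J + m^(r+1)], so the codimension of [J + m^N] is at most a
    constant times [N^(e-1)]. The chain of primes forces growth of degree [d >= e]. *)
Lemma prime_chain_in_q d (P : nat -> ideal {mpoly R[n]}) :
  (forall i, (i <= d)%N -> prime_ideal (P i)) ->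
  (forall i, (i < d)%N -> P i `<` P i.+1) ->
  (forall f, ideal_set (P d) f -> mcoeff mnm0 f = 0) ->
  J `<=` P 0%N -> (e <= d)%N ->
  forall f, ideal_set J f -> forall N, plus_ord Q N f.
Proof.
move=> Pp Plt Pm JP ed f Jf N; apply: contrapT => Nf.
have [r [u [Ju ur urS]]] : exists r u,
    [/\ ideal_set J u, plus_ord Q r u & ~ plus_ord Q r.+1 u].
  elim: N Nf => [|N IH] Nf.
    by case: Nf; apply: plus_ord_ord.
  by have [h|/IH//] := pselect (plus_ord Q N f); exists N, f.
case: ur => v Qv /is_formP [G Gr uG].
have G0 : G != 0.
  apply: contra_notN urS => /eqP G0; move: uG; rewrite G0 /ev mmap0 subr0.
  by move=> /plus_ordD/(_ (plus_ord_ideal _ Qv)); rewrite subrK.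
have JG : plus_ord J r.+1 (ev G).
  have -> : ev G = -1 *: (u - v - ev G) + (u - v) by rewrite scaleN1r; ring.
  have [_] := plus_ord_subspace J r.+1; apply.
    exact: (plus_ordS in_q_sub (leqnn _)) uG.
  by apply: plus_ord_ideal; apply: idealB => //; exact: in_q_sub.
have [C CP] := codim_ge_prime_chain Pp Plt Pm.
have bound M : (0 < M)%N -> (M ^ e <= e * r.+1 * (C * M) ^ e.-1)%N.
  move=> M0; apply: (codim_upper_bound G0 Gr JG).
  apply: codim_geS (@plus_ordS _ _ _ _ _ _ JP (leqnn _)) _.
  have [T [s [h sP]]] := CP M M0; exists T, s; split=> //.
  by apply: leq_trans h; rewrite leq_pexp2l.
(* For [e = 0] the bound at [M = 1] reads [1 <= 0]. Otherwise [M] is taken one above the constant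
   [e * r.+1 * C ^ e.-1]. *)
case: (posnP e) (bound) => [-> /(_ 1%N isT)//|e0] _.
have := bound (e * r.+1 * C ^ e.-1).+1 isT.
set M := _.+1; rewrite expnMn mulnA -[in (M ^ e)%N](prednK e0) expnS.
by rewrite leq_pmul2r ?expn_gt0 // ltnn.
Qed.

(** Krull's intersection theorem. Artin-Rees for the intersection [E] shows that each generator
    [g i] is, modulo [(q)], a combination of the [g j] with coefficients [B i j] vanishing at 0. The
    determinant of [1 - B] then carries [E] into [(q)] and equals 1 at 0. *)
Lemma in_q_krull : exists h, mcoeff mnm0 h = 1 /\
  forall f, (forall N, plus_ord Q N f) -> in_q (h * f).
Proof.
pose E := [set f | forall N, plus_ord Q N f].
have E0 : E 0 by move=> N; apply: plus_ord_ideal; exact: in_q0.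
have ED f g : E f -> E g -> E (f + g) by move=> Ef Eg N; exact: plus_ordD.
have EM f g : E g -> E (f * g) by move=> Eg N; exact: plus_ordMl.
pose EI := Ideal E0 ED EM.
have [m [g [c [gE ar]]]] := artin_rees EI.
have gP i : exists b : 'I_m -> {mpoly R[n]},
    in_q (g i - \sum_j b j * g j) /\ forall j, ord_ge 1 (b j).
  (* Order [c.+1] leaves coefficients of order at least 1 after the loss of [c]. *)
  have [v Qv gv] := gE i c.+1.
  have Ev : ideal_set EI v by move=> N; exact: plus_ord_ideal.
  have [b [gvE b1]] := ar _ _ (idealB (gE i) Ev) gv.
  by exists b; rewrite -gvE subKr; split=> // j; have := b1 j; rewrite subSnn.
have [B BP] := choice gP.
pose M : 'M[{mpoly R[n]}]_m := 1%:M - \matrix_(i, j) B i j.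
exists (\det M); split=> [|f fE].
  rewrite -(det_map_mx (mcoeff mnm0)) /=.
  rewrite [X in \det X](_ : _ = 1%:M) ?det1 //; apply/matrixP => i j.
  have B0 : mcoeff mnm0 (B i j) = 0 by apply/ord_ge1P; case: (BP i).
  rewrite !mxE mcoeffB B0 subr0.
  by case: eqP; rewrite ?mcoeff0 // mcoeff1 eqxx.
have [b [-> _]] := ar 0%N f fE (fun a _ => isT).
rewrite mulr_sumr; elim/big_ind: _ => [|x z|i _]; [exact: in_q0|exact: in_qD|].
rewrite mulrCA; apply: in_qM.
(* [M] carries the column of the [g j] into [(q)]; the adjugate passes this on to [\det M]. *)
have -> : \det M * g i = (\adj M *m (M *m \col_j g j)) i 0.
  by rewrite mulmxA mul_adj_mx mul_scalar_mx !mxE.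
rewrite mxE; elim/big_ind: _ => [|x z|j _]; [exact: in_q0|exact: in_qD|].
apply: in_qM; rewrite mulmxBl mul1mx !mxE.
by under eq_bigr do rewrite !mxE; case: (BP j).
Qed.

End RegularAtOrigin.

(** The gradients of the [q i] are completed to a spanning set of the cotangent space by
    [n - k <= d] linear forms [y j], so the number of forms does not exceed the length of the
    chain. *)
Lemma regular_origin_generators (R : realType) (n k d : nat)
    (J : ideal {mpoly R[n]}) (q : 'I_k -> {mpoly R[n]})
    (P : nat -> ideal {mpoly R[n]}) :
  (forall i, (i <= d)%N -> prime_ideal (P i)) ->
  (forall i, (i < d)%N -> P i `<` P i.+1) ->
  (forall f, ideal_set (P d) f -> mcoeff mnm0 f = 0) ->
  J `<=` P 0%N ->
  (forall i, ideal_set J (q i)) ->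
  (forall f, ideal_set J f -> mcoeff mnm0 f = 0) ->
  row_free (\matrix_(i < k, j < n) mcoeff (mnm1 j) (q i)) ->
  (n <= d + k)%N ->
  exists h, mcoeff mnm0 h = 1 /\ forall f, ideal_set J f -> in_q q (h * f).
Proof.
move=> Pp Plt Pm JP Jq Jm Qfree ndk.
set Q := \matrix_(_, _) _ in Qfree.
pose Y := row_base (Q^C)%MS.
have eE : (\rank (Q^C)%MS <= d)%N.
  by rewrite mxrank_compl (eqP Qfree); lia.
pose y j : {mpoly R[n]} := \sum_i Y j i *: mpolyX R (mnm1 i).
have y_U j i : mcoeff (mnm1 i) (y j) = Y j i.
  rewrite /y raddf_sum (bigD1 i) //= mcoeffZ mcoeffX eqxx mulr1 big1 ?addr0 //.
  by move=> i' ne; rewrite mcoeffZ mcoeffX eq_mnm1 (negPf ne) mulr0.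
have y_0 j : mcoeff mnm0 (y j) = 0.
  rewrite /y raddf_sum big1 // => i _.
  by rewrite /= mcoeffZ mcoeffX mnm1_eq0 mulr0.
have y1 j : ord_ge 1 (y j) by apply/ord_ge1P.
have cot i : exists (al : 'I_(\rank (Q^C)%MS) -> R) (be : 'I_k -> R),
    ord_ge 2 (mpolyX R (mnm1 i) - \sum_j al j *: y j - \sum_j be j *: q j).
  have /sub_addsmxP[[be al] /= dE] : ((delta_mx 0 i : 'rV[R]_n) <= Q + Y)%MS.
    rewrite (adds_eqmx (eqmx_refl Q) (eq_row_base (Q^C)%MS)).
    by rewrite submx_full // addsmx_compl_full.
  exists (al 0), (be 0); apply: ord_ge2P => [|j].
    rewrite !mcoeffB !(raddf_sum (mcoeff mnm0)) /= mcoeffX mnm1_eq0.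
    rewrite !big1 ?(oppr0, addr0) // => j _.
      by rewrite mcoeffZ Jm // mulr0.
    by rewrite mcoeffZ y_0 mulr0.
  have /rowP/(_ j) := dE; rewrite !mxE eqxx /= eq_sym => dj.
  rewrite !mcoeffB !(raddf_sum (mcoeff (mnm1 j))) /= mcoeffX eq_mnm1 dj.
  rewrite [X in X + _ - _ - _](_ : _ = \sum_j0 mcoeff (mnm1 j) (be 0 j0 *: q j0)).
    rewrite [X in _ + X - _ - _](_ : _ = \sum_j0 mcoeff (mnm1 j) (al 0 j0 *: y j0)).
      by rewrite addrK subrr.
    by apply: eq_bigr => l _; rewrite mcoeffZ y_U.
  by apply: eq_bigr => l _; rewrite mcoeffZ mxE.
have [h [h0 hP]] := in_q_krull q; exists h; split=> // f Jf.
by apply: hP; apply: (prime_chain_in_q Jq y1 cot Pp Plt Pm JP eE).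
Qed.

(** * Preimages of ideals *)

Section PreimageIdeal.
Variables (A B : comPzRingType) (phi : A -> B).
Hypothesis phiD : forall x y, phi (x + y) = phi x + phi y.
Hypothesis phiM : forall x y, phi (x * y) = phi x * phi y.
Hypothesis phi1 : phi 1 = 1.
Variable K : ideal B.

Lemma preim_has0 : (phi @^-1` K) 0.
Proof.
have phi0 : phi 0 = 0 by apply: (addIr (phi 0)); rewrite -phiD !add0r.
by rewrite /preimage /= phi0; exact: ideal_has0.
Qed.

Lemma preimD x y : (phi @^-1` K) x -> (phi @^-1` K) y -> (phi @^-1` K) (x + y).
Proof. by rewrite /preimage /= phiD; exact: idealD. Qed.

Lemma preimMl a x : (phi @^-1` K) x -> (phi @^-1` K) (a * x).
Proof. by rewrite /preimage /= phiM; exact: idealMl. Qed.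

Definition ideal_preim : ideal A := Ideal preim_has0 preimD preimMl.

Lemma ideal_preim_prime : prime_ideal K -> prime_ideal ideal_preim.
Proof.
move=> [K1 KM]; split; first by rewrite /= /preimage /= phi1.
by move=> x y; rewrite /= /preimage /= phiM => /KM.
Qed.

End PreimageIdeal.

(** * Translation to a point and gradients *)

Section Gradient.
Variables (R : realType) (n : nat).
Implicit Types (p : 'rV[R]_n) (f g : {mpoly R[n]}).

Lemma mpoly_rmorph_eq (S : comNzRingType) (phi psi : {rmorphism {mpoly R[n]} -> S}) :
  (forall c, phi (mpolyC n c) = psi (mpolyC n c)) ->
  (forall i, phi (mpolyX R (mnm1 i)) = psi (mpolyX R (mnm1 i))) -> phi =1 psi.
Proof.
move=> eC eX f; rewrite [f]mpolyE !rmorph_sum; apply: eq_bigr => a _ /=.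
rewrite -mul_mpolyC !rmorphM eC; congr (_ * _).
rewrite mpolyXE_id !rmorph_prod; apply: eq_bigr => i _.
by rewrite !rmorphXn eX.
Qed.

Definition shift p f : {mpoly R[n]} :=
  mmap (@mpolyC n R) (fun i => mpolyX R (mnm1 i) + mpolyC n (p ord0 i)) f.
HB.instance Definition _ p := GRing.RMorphism.copy (shift p)
  (mmap (@mpolyC n R) (fun i => mpolyX R (mnm1 i) + mpolyC n (p ord0 i))).

Lemma shiftC p c : shift p (mpolyC n c) = mpolyC n c.
Proof. exact: mmapC. Qed.

Lemma shiftX p i :
  shift p (mpolyX R (mnm1 i)) = mpolyX R (mnm1 i) + mpolyC n (p ord0 i).
Proof. by rewrite /shift mmapX mmap1U. Qed.

Lemma shiftK p : cancel (shift p) (shift (- p)).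
Proof.
apply: (@mpoly_rmorph_eq _ (shift (- p) \o shift p) idfun) => [c|i] /=.
  by rewrite !shiftC.
by rewrite shiftX rmorphD /= shiftX shiftC mxE mpolyCN addrNK.
Qed.

Lemma shiftNK p : cancel (shift (- p)) (shift p).
Proof. by rewrite -{2}[p]opprK; exact: shiftK. Qed.

Lemma mcoeff0_shift p f : mcoeff mnm0 (shift p f) = eval_at p f.
Proof.
rewrite /eval_at; move: f; apply: (@mpoly_rmorph_eq _
  (mcoeff mnm0 \o shift p) (meval (fun i => p ord0 i))) => [c|i] /=.
  by rewrite shiftC mcoeffC eqxx mulr1 mevalC.
by rewrite shiftX mcoeffD mcoeffX mnm1_eq0 add0r mcoeffC eqxx mulr1 mevalXU.
Qed.

(** The row of partial derivatives at [p], read off the Taylor expansion there so that it matches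
    the linear coefficients used at the origin. *)
Definition grad p f : 'rV[R]_n := \row_j mcoeff (mnm1 j) (shift p f).

Lemma mcoeff_mnm1M i f g : mcoeff (mnm1 i) (f * g) =
  mcoeff mnm0 f * mcoeff (mnm1 i) g + mcoeff mnm0 g * mcoeff (mnm1 i) f.
Proof.
have dE h : mcoeff (mnm1 i) h = mcoeff mnm0 (mderiv i h).
  by rewrite mcoeff_deriv add0m mnm0E.
by rewrite !dE mderivM mcoeffD !rmorphM /= addrC [X in _ + X]mulrC.
Qed.

Lemma gradM p f g :
  grad p (f * g) = eval_at p f *: grad p g + eval_at p g *: grad p f.
Proof.
by apply/rowP => j; rewrite !mxE rmorphM /= mcoeff_mnm1M !mcoeff0_shift.
Qed.

Lemma gradD p f g : grad p (f + g) = grad p f + grad p g.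
Proof. by apply/rowP => j; rewrite !mxE rmorphD /= mcoeffD. Qed.

Lemma gradC p c : grad p (mpolyC n c) = 0.
Proof.
by apply/rowP => j; rewrite !mxE shiftC mcoeffC mnm1_eq0 mulr0.
Qed.

Lemma gradX p i : grad p (mpolyX R (mnm1 i)) = delta_mx 0 i.
Proof.
apply/rowP => j; rewrite !mxE shiftX mcoeffD mcoeffX eq_mnm1 mcoeffC mnm1_eq0.
by rewrite mulr0 addr0 eqxx eq_sym.
Qed.

Lemma gradZ p c f : grad p (c *: f) = c *: grad p f.
Proof. by rewrite -mul_mpolyC gradM gradC scaler0 addr0 /eval_at mevalC. Qed.

Lemma grad0 p : grad p 0 = 0.
Proof. by rewrite -mpolyC0 gradC. Qed.

Lemma grad_sum p (T : Type) (r : seq T) (Q : pred T) (F : T -> {mpoly R[n]}) :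
  grad p (\sum_(i <- r | Q i) F i) = \sum_(i <- r | Q i) grad p (F i).
Proof. by apply: big_morph; [exact: gradD|exact: grad0]. Qed.

(** The case of the origin, transported by translation: ideals are pulled back along [shift (- p)]
    and polynomials moved by [shift p]. *)
Lemma regular_generators (k d : nat) p (J : ideal {mpoly R[n]})
    (q : 'I_k -> {mpoly R[n]}) (P : nat -> ideal {mpoly R[n]}) :
  (forall i, (i <= d)%N -> prime_ideal (P i)) ->
  (forall i, (i < d)%N -> P i `<` P i.+1) ->
  (forall f, ideal_set (P d) f -> eval_at p f = 0) ->
  J `<=` P 0%N ->
  (forall i, ideal_set J (q i)) ->
  (forall f, ideal_set J f -> eval_at p f = 0) ->
  row_free (\matrix_i grad p (q i)) ->
  (n <= d + k)%N ->
  exists h, eval_at p h = 1 /\ forall f, ideal_set J f -> in_q q (h * f).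
Proof.
move=> Pp Plt Pm JP Jq Jm Qfree ndk.
have sM := rmorphM (shift (- p)); have s1 := rmorph1 (shift (- p)).
have sD := rmorphD (shift (- p)).
pose pb K := ideal_preim sD sM K.
have [||||||||h [h0 hP]] := @regular_origin_generators R n k d (pb J)
    (fun i => shift p (q i)) (fun i => pb (P i)).
- by move=> i /Pp; exact: ideal_preim_prime.
- move=> i /Plt [sub nsub]; split=> [f|]; first exact: sub.
  apply: contra_not nsub => h f Pf; have := h (shift p f).
  by rewrite /= /preimage /= shiftK; apply.
- by move=> f /Pm; rewrite -mcoeff0_shift shiftNK.
- by move=> f; exact: JP.
- by move=> i; rewrite /= /preimage /= shiftK.
- by move=> f /Jm; rewrite -mcoeff0_shift shiftNK.
- rewrite [X in row_free X](_ : _ = \matrix_i grad p (q i)) //.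
  by apply/matrixP => i j; rewrite !mxE.
- exact: ndk.
exists (shift (- p) h); rewrite -mcoeff0_shift shiftNK; split=> // f Jf.
have [|c hf] := hP (shift p f); first by rewrite /= /preimage /= shiftK.
exists (fun i => shift (- p) (c i)); rewrite -[f in LHS](shiftK p) -rmorphM hf.
by rewrite rmorph_sum; apply: eq_bigr => i _; rewrite rmorphM /= shiftK.
Qed.

End Gradient.

(** * Reading regularity of the local ring in terms of polynomials *)

Section LocalRing.
Variables (R : realType) (n : nat) (J : ideal {mpoly R[n]}) (p : 'rV[R]_n).
Hypothesis Jp : real_variety J p.
Let A := local_ring_at J p.
Implicit Types (f g h : {mpoly R[n]}) (x : A).

Definition loc f : A := Defs.frac (quot_pi J f) (denom1 (nonvanishing J p)).

Lemma locD f g : loc (f + g) = loc f + loc g.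
Proof.
rewrite [RHS]loc_addE; apply: Defs.frac_eq => /=.
by rewrite !mulr1 quot_piD.
Qed.

Lemma loc0 : loc 0 = 0.
Proof. by apply: (addIr (loc 0)); rewrite -locD !add0r. Qed.

Lemma locM f g : loc (f * g) = loc f * loc g.
Proof.
rewrite [RHS]loc_mulE; apply: Defs.frac_eq => /=.
by rewrite !mulr1 quot_piM.
Qed.

Lemma loc1 : loc 1 = 1. Proof. by []. Qed.

Lemma loc_unit h : eval_at p h <> 0 -> exists x, x * loc h = 1.
Proof.
move=> hp; have Sh : mulset_set (nonvanishing J p) (quot_pi J h) by exists h.
exists (Defs.frac 1 (mk_denom Sh)); rewrite [LHS]loc_mulE; apply: Defs.frac_eq => /=.
by rewrite !mulr1 !mul1r.
Qed.

Lemma loc_fraction x : exists f h, eval_at p h <> 0 /\ x * loc h = loc f.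
Proof.
rewrite -[x]loc_fracK; move: (loc_num x) (loc_den x) => a s.
have [h hp hs] := denomP s; exists (repr a), h; split=> //.
rewrite [LHS]loc_mulE; apply: Defs.frac_eq => /=.
by rewrite quot_piK hs !mulr1.
Qed.

Lemma loc_eq f g :
  loc f = loc g <-> exists u, eval_at p u <> 0 /\ ideal_set J (u * (f - g)).
Proof.
rewrite Defs.fracE /=; split=> [[_ [u up <-]]|[u [up Ju]]].
  rewrite !mulr1 -![_ * quot_pi _ _]quot_piM => /quot_piE.
  by rewrite -mulrBr; exists u.
exists (quot_pi J u); first by exists u.
by rewrite !mulr1 -![_ * quot_pi _ _]quot_piM; apply/quot_piE; rewrite -mulrBr.
Qed.

Let eval_neq0M f g :
  eval_at p f <> 0 -> eval_at p g <> 0 -> eval_at p (f * g) <> 0.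
Proof.
by rewrite /eval_at mevalM => /eqP f0 /eqP g0; apply/eqP; rewrite mulf_neq0.
Qed.

Section LocIdeal.
Variable Y : ideal {mpoly R[n]}.

Let LY : set A :=
  [set x | exists f h, [/\ eval_at p h <> 0, ideal_set Y f & x * loc h = loc f]].

Let LY0 : LY 0.
Proof.
exists 0, 1; split; last by rewrite mul0r loc0.
  by rewrite /eval_at meval1; apply/eqP; exact: oner_neq0.
exact: ideal_has0.
Qed.

Let LYD x y : LY x -> LY y -> LY (x + y).
Proof.
move=> [f [h [h0 Yf xh]]] [g [k [k0 Yg yk]]]; exists (f * k + g * h), (h * k).
split; first exact: eval_neq0M.
  by apply: idealD; rewrite mulrC; exact: idealMl.
by rewrite locD !locM -xh -yk; ring.
Qed.

Let LYM a x : LY x -> LY (a * x).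
Proof.
move=> [f [h [h0 Yf xh]]]; have [g [k [k0 ak]]] := loc_fraction a.
exists (g * f), (k * h); split; [exact: eval_neq0M|exact: idealMl|].
by rewrite !locM -ak -xh; ring.
Qed.

Definition loc_ideal : ideal A := Ideal LY0 LYD LYM.

End LocIdeal.

Let mp0 : eval_at p 0 = 0. Proof. exact: meval0. Qed.
Let mpD f g : eval_at p f = 0 -> eval_at p g = 0 -> eval_at p (f + g) = 0.
Proof. by rewrite /eval_at mevalD => -> ->; rewrite addr0. Qed.
Let mpM f g : eval_at p g = 0 -> eval_at p (f * g) = 0.
Proof. by rewrite /eval_at mevalM => ->; rewrite mulr0. Qed.
Let mp : ideal {mpoly R[n]} :=
  @Ideal _ [set f | eval_at p f = 0] mp0 mpD mpM.

(** Properness holds because [J] vanishes at [p]. A fraction outside this ideal has a numerator that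
    is non-zero at [p], hence a unit. *)
Lemma loc_ideal_maximal : maximal_ideal (loc_ideal mp).
Proof.
split=> [[f [h [h0 fp]]]|K MK K1 x Kx].
  rewrite mul1r => /loc_eq[u [u0 /Jp]]; rewrite /eval_at mevalM mevalB.
  move: fp; rewrite /= /eval_at => ->; rewrite subr0 => /eqP.
  by rewrite mulf_eq0 => /orP[/eqP /u0|/eqP /h0].
have [f [h [h0 xh]]] := loc_fraction x; exists f, h; split=> //=.
apply: contrapT => /loc_unit[z zf]; apply: K1.
by rewrite -zf -xh; apply: idealMl; rewrite mulrC; exact: idealMl.
Qed.

(** The chain of primes is pulled back along [loc], and the [d] generators of the maximal ideal are
    cleared of denominators to give the [y i]. Equality in the localization costs the factor [u]. *)
Lemma nonsingular_chain : nonsingular J p ->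
  exists (d : nat) (P : nat -> ideal {mpoly R[n]}) (y : 'I_d -> {mpoly R[n]}),
  [/\ forall i, (i <= d)%N -> prime_ideal (P i),
      forall i, (i < d)%N -> P i `<` P i.+1,
      forall f, ideal_set (P d) f -> eval_at p f = 0,
      J `<=` P 0%N
    & (forall i, eval_at p (y i) = 0) /\
      forall f, eval_at p f = 0 -> exists (u : {mpoly R[n]})
        (c : 'I_d -> {mpoly R[n]}),
        eval_at p u <> 0 /\ ideal_set J (u * f - \sum_i c i * y i)].
Proof.
move=> [_ [m [[_ mU] [d [[[P [Pp Plt]] _] [[s sd sgen] _]]]]]].
have mE := mU _ loc_ideal_maximal.
have sP (i : 'I_d) : exists f h,
    [/\ eval_at p h <> 0, eval_at p f = 0 & s`_i * loc h = loc f].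
  have : ideal_set m s`_i.
    by rewrite -sgen => K; apply; rewrite /= mem_nth // sd.
  by rewrite -mE.
have [y yP] := choice sP.
pose Y := Ideal (in_q0 y) (@in_qD _ _ _ y) (@in_qM _ _ _ y).
exists d, (fun i => ideal_preim locD locM (P i)), y; split.
- by move=> i /Pp; apply: ideal_preim_prime.
- move=> i /Plt[sub nsub]; split=> [f|]; first exact: sub.
  apply: contra_not nsub => le x Px; have [f [h [/loc_unit[z zh] xh]]] := loc_fraction x.
  have /le : ideal_set (ideal_preim locD locM (P i.+1)) f.
    by rewrite /= /preimage /= -xh mulrC; exact: idealMl.
  rewrite /= /preimage /= -xh => Pxh.
  by rewrite -[x]mulr1 -zh mulrCA; exact: idealMl.
- move=> f Pf; apply: contrapT => /loc_unit[z zf].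
  by have [P1 _] := Pp d (leqnn d); apply: P1; rewrite -zf; exact: idealMl.
- move=> f Jf; rewrite /= /preimage /=.
  have -> : loc f = loc 0.
    apply/loc_eq; exists 1; rewrite subr0 mul1r; split=> //.
    by rewrite /eval_at meval1; apply/eqP; exact: oner_neq0.
  exact: (ideal_has0 (ideal_preim locD locM (P 0%N))).
- split=> [i|f fp]; first by have [h []] := yP i.
  have mf : ideal_set m (loc f).
    rewrite -mE; exists f, 1; split=> //; last by rewrite loc1 mulr1.
    by rewrite /eval_at meval1; apply/eqP; exact: oner_neq0.
  (* Each generator of [m] is some [y i] up to a unit, so [m] lies in the extension of the ideal
     generated by the [y i]. *)
  have [g [h [h0 [c gE] fh]]] : ideal_set (loc_ideal Y) (loc f).
    move: mf; rewrite -sgen; apply => x /= /(nthP 0)[j js <-].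
    rewrite sd in js; have [g [h0 _ sh]] := yP (Ordinal js).
    by exists (y (Ordinal js)), g; split=> //; exact: in_q_gen.
  move: fh; rewrite -locM => /loc_eq[u [u0 Ju]].
  exists (u * h), (fun i => u * c i); split; first exact: eval_neq0M.
  rewrite (_ : _ - _ = u * (f * h - g)) // gE mulrBr mulr_sumr.
  congr (_ - _); first by ring.
  by apply: eq_bigr => i _; rewrite mulrA.
Qed.

End LocalRing.

(** * Homogeneous parts for the weight [w] *)

Section HomogeneousParts.
Variables (R : realType) (n : nat) (w : 'rV[R]_n).
Implicit Types (f g q : {mpoly R[n]}) (l D : R).

Definition whomog l f := forall a, a \in msupp f -> wdot w a = l.
Definition wltb l f := forall a, a \in msupp f -> wdot w a < l.

Definition wpart l f : {mpoly R[n]} :=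
  \sum_(a <- msupp f | wdot w a == l) mcoeff a f *: mpolyX R a.

Lemma mcoeff_wpart l f a :
  mcoeff a (wpart l f) = if wdot w a == l then mcoeff a f else 0.
Proof.
rewrite /wpart raddf_sum /=.
under eq_bigr do rewrite mcoeffZ mcoeffX.
have [af|af] := boolP (a \in msupp f); last first.
  rewrite (memN_msupp_eq0 af) if_same big_seq_cond big1 // => b /andP[bf _].
  by case: eqP => [ba|]; rewrite ?mulr0 //; rewrite -ba bf in af.
rewrite big_mkcond (bigD1_seq a) ?msupp_uniq //= eqxx mulr1 big1 ?addr0 //.
by move=> b /negPf->; rewrite mulr0 if_same.
Qed.

Lemma wpart_whomog l f : whomog l (wpart l f).
Proof.
move=> a; rewrite mcoeff_msupp mcoeff_wpart.
by case: (wdot w a =P l) => // _; rewrite eqxx.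
Qed.

Lemma wpartD l f g : wpart l (f + g) = wpart l f + wpart l g.
Proof.
apply/mpolyP => a; rewrite mcoeffD !mcoeff_wpart mcoeffD.
by case: eqP => // _; rewrite addr0.
Qed.

Lemma wpart0 l : wpart l 0 = 0.
Proof. by apply/mpolyP => a; rewrite mcoeff_wpart mcoeff0 if_same. Qed.

Lemma wpart_sum l (T : Type) (r : seq T) (P : pred T) (F : T -> {mpoly R[n]}) :
  wpart l (\sum_(i <- r | P i) F i) = \sum_(i <- r | P i) wpart l (F i).
Proof. by apply: big_morph; [exact: wpartD|exact: wpart0]. Qed.

Lemma wpartM l D f q : whomog D q -> wpart l (f * q) = wpart (l - D) f * q.
Proof.
move=> qD; apply/mpolyP => a; rewrite mcoeff_wpart !mcoeffM.
have qz (b : multinom n) : wdot w b != D -> mcoeff b q = 0.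
  by move=> bD; apply: memN_msupp_eq0; apply: contra bD => /qD ->.
case: eqP => [al|al].
  apply: eq_bigr => -[b c] /= /eqP aE.
  have [cD|/qz->] := eqVneq (wdot w c) D; last by rewrite !mulr0.
  have aw : wdot w a = wdot w b + D by rewrite -cD -wdotD -aE.
  have bl : wdot w b = l - D by rewrite -al aw addrK.
  by rewrite mcoeff_wpart bl eqxx.
rewrite big1 // => -[b c] /= /eqP aE.
have [cD|/qz->] := eqVneq (wdot w c) D; last by rewrite mulr0.
rewrite mcoeff_wpart; case: eqP; rewrite ?mul0r // => bl.
have aw : wdot w a = wdot w b + D by rewrite -cD -wdotD -aE.
by case: al; rewrite aw bl subrK.
Qed.

(** A polynomial is the sum of its parts over the weights of its support, so they cannot all vanish
    at [p]. *)
Lemma wpart_eval_neq0 (p : 'rV[R]_n) f :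
  eval_at p f != 0 -> exists l, eval_at p (wpart l f) != 0.
Proof.
move=> fp; apply: contrapT => /forallNP h; move/eqP: fp; apply.
have -> : f = \sum_(l <- undup [seq wdot w a | a <- msupp f]) wpart l f.
  apply/mpolyP => a; rewrite raddf_sum /=.
  under eq_bigr do rewrite mcoeff_wpart.
  have [af|af] := boolP (a \in msupp f); last first.
    by rewrite (memN_msupp_eq0 af) big1 // => i _; rewrite if_same.
  rewrite (bigD1_seq (wdot w a)) ?undup_uniq ?mem_undup ?map_f //= eqxx.
  by rewrite big1 ?addr0 // => l; rewrite eq_sym => /negPf->.
rewrite /eval_at raddf_sum big1 // => l _.
by apply/eqP; apply: contrapT => /negP; exact: h.
Qed.

Lemma in_wE f : in_w w f = wpart (deg_w w f) f.
Proof. by []. Qed.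

Lemma in_w_whomog f : whomog (deg_w w f) (in_w w f).
Proof. exact: wpart_whomog. Qed.

Lemma sub_in_w_wltb f : wltb (deg_w w f) (f - in_w w f).
Proof.
move=> a; rewrite mcoeff_msupp mcoeffB in_wE mcoeff_wpart.
case: (wdot w a =P _) => [_|/eqP ne]; first by rewrite subrr eqxx.
by rewrite subr0 -mcoeff_msupp lt_neqAle ne; exact: deg_w_ub.
Qed.

Lemma wltbM l D f g : whomog l f -> wltb D g -> wltb (l + D) (f * g).
Proof.
move=> fl gD a /msuppM_le /allpairsP[[b c] [/= /fl bl /gD cD ->]].
by rewrite wdotD bl ltrD2l.
Qed.

Lemma wltbB l f g : wltb l f -> wltb l g -> wltb l (f - g).
Proof.
by move=> fl gl a /msuppB_le; rewrite mem_cat => /orP[/fl|/gl].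
Qed.

Lemma wltb_sum l (T : Type) (r : seq T) (P : pred T) (F : T -> {mpoly R[n]}) :
  (forall i, P i -> wltb l (F i)) -> wltb l (\sum_(i <- r | P i) F i).
Proof.
move=> h; elim/big_ind: _ => // [a|f g fl gl a]; first by rewrite msupp0.
by move=> /msuppD_le; rewrite mem_cat => /orP[/fl|/gl].
Qed.

(** Finiteness of the support turns a strict bound into a weak one with a smaller constant, the form
    that [strong_basis] propagates. *)
Lemma wltb_wbound l f : wltb l f -> exists2 B, B < l & wbound w B f.
Proof.
move=> fl; have [->|f0] := eqVneq f 0.
  by exists (l - 1); [rewrite ltrBlDr ltrDl|move=> a; rewrite msupp0].
have [a af aE] := deg_w_attained w f0; exists (deg_w w f).
  by rewrite -aE; exact: fl.
by move=> b; exact: deg_w_ub.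
Qed.

End HomogeneousParts.

(** * Lifting generators from the initial ideal to [I] *)

Section InitialSystem.
Variables (R : realType) (n : nat) (I : ideal {mpoly R[n]}) (w p : 'rV[R]_n).
Hypothesis Jp : real_variety (in_ideal w I) p.

Lemma in_w_in_ideal f : ideal_set I f -> ideal_set (in_ideal w I) (in_w w f).
Proof. by move=> If K; apply; exists f. Qed.

Definition grad_mx k (F : 'I_k -> {mpoly R[n]}) : 'M[R]_(k, n) :=
  \matrix_i grad p (in_w w (F i)).

(** A maximal family of members of [I] whose initial forms have independent gradients; its size is
    at most [n]. Restricting the choice to initial forms loses nothing, since these generate the
    initial ideal and vanish at [p]. *)
Lemma initial_gradient_basis : exists (k : nat) (F : 'I_k -> {mpoly R[n]}),
  [/\ forall i, ideal_set I (F i), row_free (grad_mx F)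
    & forall f, ideal_set (in_ideal w I) f -> (grad p f <= grad_mx F)%MS].
Proof.
pose ok k := exists F : 'I_k -> {mpoly R[n]},
  (forall i, ideal_set I (F i)) /\ row_free (grad_mx F).
have ok0 : exists k, `[< ok k >].
  exists 0%N; apply/asboolP; exists (fun=> 0); split=> [[]//|].
  by rewrite /row_free -leqn0 rank_leq_row.
have okn k : `[< ok k >] -> (k <= n)%N.
  by move=> /asboolP[F [_ /eqP <-]]; exact: rank_leq_col.
case: (ex_maxnP ok0 okn) => k /asboolP[F [IF Ffree]] kmax.
exists k, F; split=> //.
have base f : ideal_set I f -> (grad p (in_w w f) <= grad_mx F)%MS.
  move=> If; apply/negPn/negP => nsub.
  suff /kmax : `[< ok (1 + k)%N >] by rewrite ltnn.
  apply/asboolP.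
  exists (fun i => match fintype.split i with inl _ => f | inr j => F j end).
  split=> [i|]; first by case: fintype.split.
  have -> : grad_mx (fun i : 'I_(1 + k) =>
      match fintype.split i with inl _ => f | inr j => F j end) =
      col_mx (grad p (in_w w f)) (grad_mx F).
    apply/row_matrixP => i; rewrite rowK.
    case: (split_ordP i) => j ->.
      by rewrite rowKu ord1; apply/rowP => l; rewrite !mxE.
    by rewrite rowKd rowK.
  rewrite /row_free eqn_leq rank_leq_row /= -addsmxE.
  rewrite add1n -{1}(eqP Ffree); apply: rank_ltmx.
  rewrite ltmxE addsmxSr; apply: contra nsub => h.
  exact: submx_trans (addsmxSl _ _) h.
(* Vanishing at [p] is included because it makes the product rule read
   [grad p (f * g) = f(p) *: grad p g], so that [S] is an ideal. *)
pose S : set {mpoly R[n]} :=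
  [set f | eval_at p f = 0 /\ (grad p f <= grad_mx F)%MS].
have S0 : S 0 by rewrite /S /= /eval_at meval0 grad0 sub0mx.
have SD f g : S f -> S g -> S (f + g).
  move=> [fp fs] [gp gs]; split; last by rewrite gradD addmx_sub.
  by move: fp gp; rewrite /eval_at mevalD => -> ->; rewrite addr0.
have SM f g : S g -> S (f * g).
  move=> [gp gs]; split; last by rewrite gradM gp scale0r addr0 scalemx_sub.
  by move: gp; rewrite /eval_at mevalM => ->; rewrite mulr0.
move=> f Jf; suff [] : S f by [].
apply: (Jf (Ideal S0 SD SM)) => _ [g Ig <-]; split; last exact: base.
by apply: Jp; exact: in_w_in_ideal.
Qed.

(** The inequality [n <= d + k] comes from the cotangent space: some [u * (x_i - p_i)] with
    [u(p) <> 0] is a combination of the [y j] plus a member of the initial ideal. Taking gradients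
    at [p] and dividing by [u(p)] puts every basis vector in the span of [d + k] rows. *)
Lemma initial_generators : nonsingular (in_ideal w I) p ->
  exists (k : nat) (F : 'I_k -> {mpoly R[n]}),
  [/\ forall i, ideal_set I (F i), row_free (grad_mx F)
    & exists h, eval_at p h = 1 /\ forall f, ideal_set (in_ideal w I) f ->
        in_q (fun i => in_w w (F i)) (h * f)].
Proof.
move=> /(nonsingular_chain Jp)[d [P [y [Pp Plt Pm JP [yp yP]]]]].
have [k [F [IF Ffree Fspan]]] := initial_gradient_basis.
exists k, F; split=> //; apply: (regular_generators Pp Plt Pm JP) => //.
- by move=> i; exact: in_w_in_ideal.
pose Y : 'M[R]_(d, n) := \matrix_i grad p (y i).
suff full : (1%:M <= Y + grad_mx F)%MS.
  rewrite -[n](mxrank1 R); apply: leq_trans (mxrankS full) _.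
  apply: leq_trans (mxrank_adds_leqif _ _) _.
  by rewrite leq_add ?rank_leq_row.
apply/row_subP => i; rewrite row1.
pose f := mpolyX R (mnm1 i) - mpolyC n (p ord0 i).
have fp : eval_at p f = 0 by rewrite /eval_at mevalB mevalXU mevalC subrr.
have fE : grad p f = delta_mx 0 i.
  by rewrite /f -mpolyCN gradD gradC gradX addr0.
have [u [c [u0 Jg]]] := yP f fp; have := Fspan _ Jg.
move: Jg => /Jp _; set g := _ - _ => gF.
have : grad p (u * f) = grad p g + grad p (\sum_i c i * y i).
  by rewrite -gradD subrK.
rewrite gradM fp scale0r addr0 fE grad_sum => dE.
have -> : delta_mx 0 i = (eval_at p u)^-1 *: (eval_at p u *: delta_mx 0 i) :> 'rV[R]_n.
  by rewrite scalerA mulVf ?scale1r //; apply/eqP.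
rewrite dE scalemx_sub // addmx_sub //.
  exact: submx_trans gF (addsmxSr _ _).
apply: submx_trans (addsmxSl _ _); apply: summx_sub => j _.
rewrite gradM yp scale0r addr0 scalemx_sub //.
by have := row_sub j Y; rewrite rowK.
Qed.

(* The multiplier [h] is made w-homogeneous so that comparing initial forms
   shows that the error term [\sum_j' b j j' * g j'] has smaller weight. *)
Lemma initial_system : nonsingular (in_ideal w I) p ->
  exists (k : nat) (F : 'I_k -> {mpoly R[n]}) (m : nat)
    (g : 'I_m -> {mpoly R[n]}) (l : R) (h : {mpoly R[n]})
    (c : 'I_m -> 'I_k -> {mpoly R[n]}) (b : 'I_m -> 'I_m -> {mpoly R[n]}),
  [/\ (forall i, ideal_set I (F i)) /\ row_free (grad_mx F),
      forall f, ideal_set I f -> in_q g f,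
      whomog w l h /\ eval_at p h != 0,
      forall j, h * g j = \sum_i c j i * F i + \sum_j' b j j' * g j'
    & forall j j', wltb w (l + deg_w w (g j) - deg_w w (g j')) (b j j')].
Proof.
move=> /initial_generators[k [F [IF Ffree [h0 [h0p h0P]]]]].
have [m [g [gI gP]]] := strong_basis w I.
have [|l hp] := @wpart_eval_neq0 _ _ w p h0; first by rewrite h0p oner_neq0.
set h := wpart w l h0 in hp.
have cP j : exists c : 'I_k -> {mpoly R[n]},
    wltb w (l + deg_w w (g j)) (h * g j - \sum_i c i * F i).
  have [Ig g0] := gI j; have [c0 c0E] := h0P _ (in_w_in_ideal Ig).
  (* The weight that makes [c i * in_w w (F i)] homogeneous of weight [l + deg_w w (g j)]. *)
  pose c i := wpart w (l + deg_w w (g j) - deg_w w (F i)) (c0 i).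
  have hE : h * in_w w (g j) = \sum_i c i * in_w w (F i).
    transitivity (wpart w (l + deg_w w (g j)) (h0 * in_w w (g j))).
      by rewrite (wpartM _ _ (@in_w_whomog _ _ w (g j))) addrK.
    rewrite c0E wpart_sum; apply: eq_bigr => i _.
    by rewrite (wpartM _ _ (@in_w_whomog _ _ w (F i))).
  (* By [hE] the leading parts cancel and only tails of strictly smaller weight remain. *)
  exists c; have -> : h * g j - \sum_i c i * F i =
      h * (g j - in_w w (g j)) - \sum_i c i * (F i - in_w w (F i)).
    rewrite mulrBr hE; under [X in _ = _ - X]eq_bigr do rewrite mulrBr.
    by rewrite sumrB; ring.
  apply: wltbB; first by apply: wltbM (@sub_in_w_wltb _ _ w _); exact: wpart_whomog.
  apply: wltb_sum => i _; rewrite -[l + _](subrK (deg_w w (F i))).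
  by apply: wltbM (@sub_in_w_wltb _ _ w _); exact: wpart_whomog.
have [c {}cP] := choice cP.
have bP j : exists b : 'I_m -> {mpoly R[n]},
    h * g j = \sum_i c j i * F i + \sum_j' b j' * g j' /\
    forall j', wltb w (l + deg_w w (g j) - deg_w w (g j')) (b j').
  have [B Bl rB] := wltb_wbound (cP j).
  have [|b [rE bB]] := gP (h * g j - \sum_i c j i * F i).
    apply: idealB; first by apply: idealMl; case: (gI j).
    by apply: ideal_sum => i _; exact: idealMl.
  exists b; rewrite -rE addrC subrK; split=> // j' a ab.
  by rewrite ltrBrDr; apply: le_lt_trans Bl; exact: bB.
have [b {}bP] := choice bP.
exists k, F, m, g, l, h, c, b; split=> //.
- by move=> f /gP[e [-> _]]; exists e.
- by split=> //; exact: wpart_whomog.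
- by move=> j; case: (bP j).
- by move=> j; case: (bP j).
Qed.

End InitialSystem.

(** * Limits and norms of row vectors *)

(** Makes row vectors a complete normed space for the fixed point theorem used in
    [perturbed_zero]. *)
HB.instance Definition _ (R : realType) m n := Complete.on 'M[R]_(m, n).

Lemma cvg_ext (T U : Type) (F : set_system T) (G : set_system U) (f g : T -> U) :
  f =1 g -> f x @[x --> F] --> G -> g x @[x --> F] --> G.
Proof. by move=> /funext ->. Qed.

Lemma cvg_app (T U V : Type) (F : set_system T) (G : set_system U)
    (H : set_system V) (f : T -> U) (g : U -> V) :
  f x @[x --> F] --> G -> g y @[y --> G] --> H -> g (f x) @[x --> F] --> H.
Proof. exact: cvg_comp. Qed.

Lemma cvg_filter_prod (T U V : Type) (F : set_system T) (G : set_system U)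
    (H : set_system V) (f : T -> U) (g : T -> V) : Filter F ->
  f x @[x --> F] --> G -> g x @[x --> F] --> H ->
  (f x, g x) @[x --> F] --> filter_prod G H.
Proof.
move=> FF fG gH A [[P Q] /= [GP HQ] PQ].
have fP : F (f @^-1` P) := fG _ GP; have gQ : F (g @^-1` Q) := gH _ HQ.
suff : F ((fun x => (f x, g x)) @^-1` A) by [].
by apply: filterS2 fP gQ => x Px Qx; exact: PQ.
Qed.

Section Limits.
Variables (R : realType) (T : Type) (F : set_system T).
Context {FF : Filter F}.

Lemma cvg_sumr (I : Type) (r : seq I) (P : pred I) (f : I -> T -> R) (l : I -> R) :
  (forall i, P i -> f i x @[x --> F] --> l i) ->
  (\sum_(i <- r | P i) f i x) @[x --> F] --> \sum_(i <- r | P i) l i.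
Proof.
move=> fl; elim: r => [|i r IH].
  by rewrite big_nil; apply: cvg_ext (cvg_cst _) => x; rewrite big_nil.
rewrite big_cons; case: ifP => Pi; last first.
  by apply: cvg_ext IH => x; rewrite big_cons Pi.
by apply: cvg_ext (cvgD (fl i Pi) IH) => x; rewrite big_cons Pi.
Qed.

Lemma cvg_row n (f : T -> 'rV[R]_n) (l : 'rV[R]_n) :
  (forall j, f x ord0 j @[x --> F] --> l ord0 j) -> f x @[x --> F] --> l.
Proof.
move=> fl A [P Pl PA].
have : \forall x \near F, forall j, P ord0 j (f x ord0 j).
  by apply: filter_forall => j; apply: fl; exact: Pl.
by apply: filterS => x Px; apply: PA => /= i j; rewrite (ord1 i); exact: Px.
Qed.

End Limits.

Section RowNorm.
Variables (R : realType) (n : nat).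
Implicit Types (v : 'rV[R]_n).

Lemma row_norm_le v e : 0 <= e -> (forall j, `|v ord0 j| <= e) -> `|v| <= e.
Proof.
move=> e0 ve; rewrite [leLHS]/Num.Def.normr /= mx_normrE; apply/bigmax_leP.
by split=> // -[i j] _ /=; rewrite (ord1 i).
Qed.

Lemma le_row_norm v j : `|v ord0 j| <= `|v|.
Proof.
rewrite [leRHS]/Num.Def.normr /= mx_normrE.
by apply: (le_bigmax _ (fun ij => `|v ij.1 ij.2|) (ord0, j)).
Qed.

End RowNorm.

Lemma pinftyP (R : realType) (A : set R) :
  (\forall c \near +oo, A c) -> exists c0, forall c, c0 < c -> A c.
Proof. by move=> [M [_ MA]]; exists M. Qed.

Lemma powR_cvg_pinfty (R : realType) (r : R) :
  r < 0 -> c `^ r @[c --> +oo] --> 0.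
Proof.
move=> r0; apply/cvgr0Pnorm_le => e e0.
near=> c.
have c0 : 0 < c by near: c; exact: nbhs_pinfty_gt.
rewrite ger0_norm ?powR_ge0 // -[r]opprK powRN -[e]invrK.
rewrite lef_pV2 ?posrE ?invr_gt0 ?powR_gt0 //.
have rN0 : 0 < - r by rewrite oppr_gt0.
have -> : e^-1 = (e^-1 `^ (- r)^-1) `^ (- r).
  by rewrite -powRrM mulVf ?gt_eqF // powRr1 // invr_ge0 ltW.
have ec : e^-1 `^ (- r)^-1 < c by near: c; apply: nbhs_pinfty_gt.
by apply: ltW; apply: gt0_ltr_powR => //; rewrite nnegrE ?powR_ge0 // ltW.
Unshelve. all: by end_near. Qed.

(** * Evaluation at rescaled points *)

Section Evaluation.
Variables (R : realType) (n : nat).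
Implicit Types (f g : {mpoly R[n]}) (p x y w : 'rV[R]_n).

Lemma mpoly_ring_ind (P : {mpoly R[n]} -> Prop) :
  (forall c, P (mpolyC n c)) -> (forall i, P (mpolyX R (mnm1 i))) ->
  (forall f g, P f -> P g -> P (f + g)) ->
  (forall f g, P f -> P g -> P (f * g)) -> forall f, P f.
Proof.
move=> PC PX PD PM f; rewrite [f]mpolyE.
elim/big_ind: _ => [||a _]; [by rewrite -mpolyC0|exact: PD|].
rewrite -mul_mpolyC mpolyXE_id; apply: (PM) => //.
elim/big_ind: _ => [||i _]; [by rewrite -mpolyC1|exact: PM|].
elim: (a i) => [|j IH]; first by rewrite expr0 -mpolyC1.
by rewrite exprS; exact: PM.
Qed.

Lemma eval_continuous p f : eval_at x f @[x --> nbhs p] --> eval_at p f.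
Proof.
elim/mpoly_ring_ind: f => [c|i|f g cf cg|f g cf cg]; rewrite /eval_at.
- rewrite mevalC; apply: (@cvg_ext _ _ _ _ (fun=> c)); last exact: cvg_cst.
  by move=> x; rewrite mevalC.
- rewrite mevalXU; apply: cvg_ext (@coord_continuous _ _ _ ord0 i p) => x.
  by rewrite mevalXU.
- by rewrite mevalD; apply: cvg_ext (cvgD cf cg) => x; rewrite mevalD.
- by rewrite mevalM; apply: cvg_ext (cvgM cf cg) => x; rewrite mevalM.
Qed.

Lemma eval_scale_X w c x a : 0 < c ->
  eval_at (scale_w w c x) (mpolyX R a) =
  c `^ wdot w a * eval_at x (mpolyX R a).
Proof.
move=> c0; rewrite /eval_at !mevalX.
have -> : c `^ wdot w a = \prod_(i < n) (c `^ w ord0 i) ^+ a i.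
  rewrite /wdot; elim/big_rec2: _ => [|i y1 y2 _ <-]; first by rewrite powRr0.
  rewrite powRD; last by rewrite (gt_eqF c0) implybT.
  by rewrite powRrM powR_mulrn // powR_ge0.
by rewrite -big_split; apply: eq_bigr => i _; rewrite mxE exprMn.
Qed.

(** For [D = deg_w w f] the exponents of [c] are at most 0, with equality exactly on the initial
    form: the rescaled polynomials degenerate to [in_w w f]. *)
Lemma eval_scale w c x D f : 0 < c ->
  c `^ (- D) * eval_at (scale_w w c x) f =
  \sum_(a <- msupp f) mcoeff a f * c `^ (wdot w a - D) * eval_at x (mpolyX R a).
Proof.
move=> c0; rewrite [f in LHS]mpolyE [eval_at _ _]raddf_sum mulr_sumr.
apply: eq_bigr => a _ /=; rewrite mevalZ.
rewrite -[meval _ _]/(eval_at (scale_w w c x) _) eval_scale_X //.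
rewrite powRD; last by rewrite (gt_eqF c0) implybT.
by ring.
Qed.

Lemma eval_scale_whomog w c x l f : 0 < c -> whomog w l f ->
  c `^ (- l) * eval_at (scale_w w c x) f = eval_at x f.
Proof.
move=> c0 fl; rewrite eval_scale // [f in RHS]mpolyE [RHS]raddf_sum.
rewrite big_seq [RHS]big_seq; apply: eq_bigr => a /fl -> /=.
by rewrite subrr powRr0 mulr1 mevalZ.
Qed.

Lemma coef_scale_cvg w f a : a \in msupp f ->
  mcoeff a f * c `^ (wdot w a - deg_w w f) @[c --> +oo] -->
  mcoeff a (in_w w f).
Proof.
move=> af; rewrite in_wE mcoeff_wpart; case: eqP => [->|/eqP ne].
  rewrite subrr; apply: (@cvg_ext _ _ _ _ (fun=> mcoeff a f)).
    by move=> c; rewrite powRr0 mulr1.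
  exact: cvg_cst.
rewrite -[0](mulr0 (mcoeff a f)); apply: cvgM; first exact: cvg_cst.
by apply: powR_cvg_pinfty; rewrite subr_lt0 lt_neqAle ne deg_w_ub.
Qed.

Lemma eval_scale_wltb_cvg w p (x : R -> 'rV[R]_n) D f : wltb w D f ->
  x c @[c --> +oo] --> p ->
  c `^ (- D) * eval_at (scale_w w c (x c)) f @[c --> +oo] --> 0.
Proof.
move=> fD xp.
(* The repeated membership condition lets [cvg_sumr] supply it for each term. *)
have h : (\sum_(a <- msupp f | a \in msupp f)
    mcoeff a f * c `^ (wdot w a - D) * eval_at (x c) (mpolyX R a))
    @[c --> +oo] --> \sum_(a <- msupp f | a \in msupp f)
    mcoeff a f * 0 * eval_at p (mpolyX R a).
  apply: cvg_sumr => a af; apply: cvgM; last first.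
    apply: (@cvg_app _ _ _ _ _ _ x (fun y => eval_at y (mpolyX R a)) xp).
    exact: eval_continuous.
  apply: cvgM; first exact: cvg_cst.
  by apply: powR_cvg_pinfty; rewrite subr_lt0; exact: fD.
rewrite [X in _ --> X](_ : _ = 0) in h; last first.
  by rewrite big1 // => a _; rewrite mulr0 mul0r.
apply: cvg_trans h; apply: near_eq_cvg; near=> c.
rewrite -big_seq eval_scale //; near: c; exact: nbhs_pinfty_gt.
Unshelve. all: by end_near. Qed.

End Evaluation.

(** * Difference quotients and zeros of perturbed systems *)

Section HadamardQuotients.
Variables (R : realType) (n : nat) (p : 'rV[R]_n).

Local Notation FP :=
  (filter_prod (pinfty_nbhs R) (filter_prod (nbhs p) (nbhs p))).

(* A parametric form of strict differentiability at [p], uniform as the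
   parameter tends to +oo. *)
Definition hadamard (phi : R -> 'rV[R]_n -> R) (L : 'rV[R]_n) :=
  exists D : 'I_n -> R * ('rV[R]_n * 'rV[R]_n) -> R,
    (forall i, D i z @[z --> FP] --> L ord0 i) /\
    forall c x y, phi c x - phi c y =
      \sum_i (x ord0 i - y ord0 i) * D i (c, (x, y)).

Let cvg_x : z.2.1 @[z --> FP] --> p.
Proof. exact: cvg_app cvg_snd cvg_fst. Qed.

Let cvg_y : z.2.2 @[z --> FP] --> p.
Proof. exact: cvg_app cvg_snd cvg_snd. Qed.

Lemma hadamardD phi psi L M : hadamard phi L -> hadamard psi M ->
  hadamard (fun c x => phi c x + psi c x) (L + M).
Proof.
move=> [D [DL DE]] [E [EM EE]]; exists (fun i z => D i z + E i z).
split=> [i|c x y]; first by rewrite mxE; exact: cvgD.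
rewrite opprD addrACA DE EE -big_split; apply: eq_bigr => i _ /=.
by rewrite mulrDr.
Qed.

Lemma hadamardZ (k : R -> R) (l : R) phi L : k c @[c --> +oo] --> l ->
  hadamard phi L -> hadamard (fun c x => k c * phi c x) (l *: L).
Proof.
move=> kl [D [DL DE]]; exists (fun i z => k z.1 * D i z).
split=> [i|c x y]; first by rewrite mxE; apply: cvgM => //; exact: cvg_app cvg_fst kl.
rewrite -mulrBr DE mulr_sumr; apply: eq_bigr => i _ /=; ring.
Qed.

Lemma hadamard_ext phi psi L : (forall c x, phi c x = psi c x) ->
  hadamard phi L -> hadamard psi L.
Proof. by move=> e [D [DL DE]]; exists D; split=> // c x y; rewrite -!e. Qed.

Lemma hadamard0 : hadamard (fun _ _ => 0) 0.
Proof.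
exists (fun _ _ => 0); split=> [i|c x y]; first by rewrite mxE; exact: cvg_cst.
by rewrite subrr big1 // => i _; rewrite mulr0.
Qed.

Lemma hadamard_sum (I : Type) (r : seq I) (P : pred I)
    (phi : I -> R -> 'rV[R]_n -> R) (L : I -> 'rV[R]_n) :
  (forall i, P i -> hadamard (phi i) (L i)) ->
  hadamard (fun c x => \sum_(i <- r | P i) phi i c x) (\sum_(i <- r | P i) L i).
Proof.
move=> h; elim: r => [|i r IH].
  rewrite big_nil; apply: hadamard_ext hadamard0 => c x.
  by rewrite big_nil.
rewrite big_cons; case: ifP => Pi.
  apply: hadamard_ext (hadamardD (h i Pi) IH) => c x.
  by rewrite big_cons Pi.
by apply: hadamard_ext IH => c x; rewrite big_cons Pi.
Qed.

(** Induction on the construction of [f] yields exact quotients that are polynomial in both points,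
    hence continuous at [(p, p)]. *)
Lemma hadamard_mpoly f : hadamard (fun _ x => eval_at x f) (grad p f).
Proof.
elim/mpoly_ring_ind: f => [c|i|f g hf hg|f g [D [DL DE]] [E [EM EE]]].
- exists (fun _ _ => 0); split=> [i|c' x y].
    by rewrite gradC mxE; exact: cvg_cst.
  by rewrite /eval_at !mevalC subrr big1 // => i _; rewrite mulr0.
- exists (fun j _ => (j == i)%:R); split=> [j|c x y].
    by rewrite gradX mxE eqxx; exact: cvg_cst.
  rewrite /eval_at !mevalXU (bigD1 i) //= eqxx mulr1 big1 ?addr0 //.
  by move=> j /negPf->; rewrite mulr0.
- rewrite gradD; apply: hadamard_ext (hadamardD hf hg) => c x.
  by rewrite /eval_at mevalD.
- exists (fun i z => eval_at z.2.1 f * E i z + eval_at z.2.2 g * D i z).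
  split=> [i|c x y].
    move: (EM i) (DL i); rewrite gradM !mxE => EMi DLi.
    apply: cvgD; apply: cvgM => //.
      apply: (@cvg_app _ _ _ _ _ _ _ (fun y => eval_at y f) cvg_x).
      exact: eval_continuous.
    apply: (@cvg_app _ _ _ _ _ _ _ (fun y => eval_at y g) cvg_y).
    exact: eval_continuous.
  transitivity (eval_at x f * (eval_at x g - eval_at y g) +
      eval_at y g * (eval_at x f - eval_at y f)).
    by rewrite /eval_at !mevalM; ring.
  rewrite (DE c) (EE c) !mulr_sumr -big_split; apply: eq_bigr => i _ /=; ring.
Qed.

Lemma hadamard_scale w f :
  hadamard (fun c x => \sum_(a <- msupp f | a \in msupp f)
    mcoeff a f * c `^ (wdot w a - deg_w w f) * eval_at x (mpolyX R a))
  (grad p (in_w w f)).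
Proof.
have -> : grad p (in_w w f) = \sum_(a <- msupp f | a \in msupp f)
    mcoeff a (in_w w f) *: grad p (mpolyX R a).
  rewrite {1}/in_w grad_sum big_mkcond -big_seq; apply: eq_bigr => a _.
  by rewrite in_wE mcoeff_wpart; case: ifP; rewrite ?scale0r // gradZ.
apply: hadamard_sum => a af; apply: hadamardZ; first exact: coef_scale_cvg.
exact: hadamard_mpoly.
Qed.

(** Zeros are sought on the slice [X s = p + s *m B^T], with [B] a right inverse of [L]. There
    [s |-> Phi c (X s)] is close to a translation, so [s |-> s - Phi c (X s)] is a contraction near
    0 for large [c], and its fixed points are the zeros. *)
Lemma perturbed_zero k (phi : 'I_k -> R -> 'rV[R]_n -> R) (L : 'M[R]_(k, n)) :
  (forall i, hadamard (phi i) (row i L)) -> row_free L ->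
  (forall i, phi i c p @[c --> +oo] --> 0) ->
  exists x : R -> 'rV[R]_n,
    (\forall c \near +oo, forall i, phi i c (x c) = 0) /\
    x c @[c --> +oo] --> p.
Proof.
move=> hphi /row_freeP[B LB] phi0; have [D DP] := choice hphi.
pose X (s : 'rV[R]_k) : 'rV[R]_n := p + s *m B^T.
pose Phi c x : 'rV[R]_k := \row_i phi i c x.
have X0 : X 0 = p by rewrite /X mul0mx addr0.
have Xcvg : X s @[s --> nbhs (0 : 'rV[R]_k)] --> p.
  apply: cvg_row => j; rewrite -X0 !mxE.
  apply: (@cvg_ext _ _ _ _ (fun s : 'rV[R]_k => p ord0 j + \sum_l s ord0 l * B^T l j)).
    by move=> s; rewrite !mxE.
  apply: cvgD; first exact: cvg_cst.
  apply: cvg_sumr => l _; apply: cvgM; last exact: cvg_cst.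
  exact: coord_continuous.
have Phi0 : Phi c p @[c --> +oo] --> (0 : 'rV[R]_k).
  apply: cvg_row => i; rewrite mxE; apply: cvg_ext (phi0 i) => c.
  by rewrite mxE.
pose G := filter_prod (pinfty_nbhs R)
  (filter_prod (nbhs (0 : 'rV[R]_k)) (nbhs (0 : 'rV[R]_k))).
pose E i l (z : R * ('rV[R]_k * 'rV[R]_k)) : R :=
  (i == l)%:R - \sum_j B j l * D i j (z.1, (X z.2.1, X z.2.2)).
have Ecvg i l : E i l z @[z --> G] --> 0.
  have -> : 0 = (i == l)%:R - \sum_j B j l * L i j :> R.
    have /matrixP/(_ i l) := LB; rewrite !mxE => <-.
    rewrite [X in _ - X](eq_bigr (fun j => L i j * B j l)) ?subrr // => j _.
    by rewrite mulrC.
  apply: cvgB; first exact: cvg_cst.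
  apply: cvg_sumr => j _; apply: cvgM; first exact: cvg_cst.
  have [/(_ j) + _] := DP i; rewrite mxE => h.
  apply: (@cvg_app _ _ _ _ _ _ (fun z : R * ('rV[R]_k * 'rV[R]_k) =>
    (z.1, (X z.2.1, X z.2.2))) (D i j) _ h).
  apply: cvg_filter_prod; first exact: cvg_fst.
  apply: cvg_filter_prod.
    exact: cvg_app (cvg_app cvg_snd cvg_fst) Xcvg.
  exact: cvg_app (cvg_app cvg_snd cvg_snd) Xcvg.
(* A sum of [k] entries bounded by [eta] is at most 1/2, the contraction ratio. *)
pose eta : R := (2 * k.+1%:R)^-1.
have eta0 : 0 < eta by rewrite invr_gt0 mulr_gt0.
have : \forall z \near G, forall il, `|E il.1 il.2 z| <= eta.
  by apply: filter_forall => il; exact: cvgr0_norm_le.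
move=> [[A U] /= [NA [[U1 U2] /= [NU1 NU2] NU]] NE].
move: NU1 NU2 => /nbhs_normP[r1 r10 NU1] /nbhs_normP[r2 r20 NU2].
have [cA cAP] := pinftyP NA.
pose r := Num.min r1 r2 / 2.
have r0 : 0 < r by rewrite divr_gt0 // lt_min r10.
have rU s : `|s| <= r -> U1 s /\ U2 s.
  move=> sr; have rmin : r < Num.min r1 r2.
    by rewrite /r ltr_pdivrMr // ltr_pMr ?ltr1n // lt_min r10.
  move: (rmin); rewrite lt_min => /andP[rr1 rr2].
  split; [apply: NU1|apply: NU2]; rewrite /ball_ /= sub0r normrN;
    exact: le_lt_trans sr _.
have small s t c : cA < c -> `|s| <= r -> `|t| <= r ->
    `|(s - Phi c (X s)) - (t - Phi c (X t))| <= 2^-1 * `|s - t|.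
  move=> cAc sr tr; apply: row_norm_le => [|i]; first by rewrite mulr_ge0.
  have -> : (s - Phi c (X s) - (t - Phi c (X t))) ord0 i =
      \sum_l (s - t) ord0 l * E i l (c, (s, t)).
    transitivity ((s - t) ord0 i - (phi i c (X s) - phi i c (X t))).
      by rewrite !mxE; ring.
    have [_ ->] := DP i.
    under [RHS]eq_bigr do rewrite /E /= mulrBr mulr_sumr.
    rewrite sumrB; congr (_ - _).
      rewrite (bigD1 i) //= eqxx mulr1 big1 ?addr0 // => l /negPf.
      by rewrite eq_sym => ->; rewrite mulr0.
    rewrite exchange_big; apply: eq_bigr => j _ /=.
    have -> : X s ord0 j - X t ord0 j = \sum_l (s - t) ord0 l * B j l.
      rewrite !mxE opprD addrACA subrr add0r -sumrB; apply: eq_bigr => l _.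
      by rewrite !mxE; ring.
    by rewrite mulr_suml; apply: eq_bigr => l _; rewrite mulrA.
  apply: le_trans (ler_norm_sum _ _ _) _.
  apply: (@le_trans _ _ (\sum_(l < k) `|s - t| * eta)).
    apply: ler_sum => l _; rewrite normrM ler_pM //; first exact: le_row_norm.
    apply: (NE (c, (s, t)) _ (i, l)); split=> /=; first exact: cAP.
    by apply: NU; split=> /=; [case: (rU s sr)|case: (rU t tr)].
  rewrite sumr_const card_ord -[X in X <= _]mulr_natr -mulrA mulrC.
  apply: ler_wpM2r => //; rewrite /eta invfM -mulrA ger_pMr ?invr_gt0 //.
  by rewrite mulrC ler_pdivrMr // mul1r ler_nat.
(* Stated for every [c], with default 0, so that [choice] applies. The bound [r / 2] keeps the ball
   of radius [r] stable; the estimate on [s] yields convergence to [p]. *)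
have sol c : exists s, cA < c -> `|Phi c p| <= r / 2 ->
    Phi c (X s) = 0 /\ `|s| <= 2 * `|Phi c p|.
  have [cAc|] := boolP (cA < c); last by exists 0.
  have [Pr|] := boolP (`|Phi c p| <= r / 2); last by exists 0.
  pose K := closed_ball_ Num.Def.normr (0 : 'rV[R]_k) r.
  have KP s : K s <-> `|s| <= r by rewrite /K /closed_ball_ /= sub0r normrN.
  have K0 : K 0 by apply/KP; rewrite normr0 ltW.
  pose t s := s - Phi c (X s).
  have t0 : `|t 0| = `|Phi c p| by rewrite /t X0 sub0r normrN.
  have tle s : `|s| <= r -> `|t s| <= 2^-1 * `|s| + `|Phi c p|.
    move=> sr; rewrite -t0 -[t s](subrK (t 0)); apply: le_trans (ler_normD _ _) _.
    by rewrite lerD2r -[in leRHS](subr0 s) small // normr0 ltW.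
  have tK : {homo t : s / K s >-> K s}.
    move=> s /KP sr; apply/KP; apply: le_trans (tle s sr) _; lra.
  have [|||s Ks sE] := @banach_fixed_point R 'rV[R]_k K (mkfun_fun tK).
  - have h2 : 0 <= 2^-1 :> R by rewrite invr_ge0.
    exists (NngNum h2); split=> /=; first by rewrite invf_lt1 ?ltr1n.
    by move=> [s s'] /= [/KP sr /KP sr']; exact: small.
  - exact: closed_closed_ball_.
  - by exists 0.
  exists s => _ _; move/KP: Ks => sr; split.
    move: sE; rewrite /= /mkfun /t => /eqP.
    by rewrite eq_sym subr_eq addrC -subr_eq subrr eq_sym => /eqP.
  have := tle s sr; rewrite -[t s]/(mkfun_fun tK s) -sE; lra.
have [s sP] := choice sol.
have sol_near : \forall c \near +oo,
    Phi c (X (s c)) = 0 /\ `|s c| <= 2 * `|Phi c p|.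
  have : \forall c \near +oo, `|Phi c p| <= r / 2.
    by apply: cvgr0_norm_le => //; rewrite divr_gt0.
  have : \forall c \near +oo, cA < c by apply: nbhs_pinfty_gt; rewrite num_real.
  by apply: filterS2 => c; exact: sP.
exists (X \o s); split.
  apply: filterS sol_near => c [/rowP Pc _] i.
  by have := Pc i; rewrite !mxE.
apply: (@cvg_app _ _ _ _ _ _ s X _ Xcvg); apply/cvgr0Pnorm_le => e e0.
have : \forall c \near +oo, `|Phi c p| <= e / 2.
  by apply: cvgr0_norm_le => //; rewrite divr_gt0.
by move: sol_near; apply: filterS2 => c [_ h1] h2; lra.
Qed.

End HadamardQuotients.

(** * Vanishing of all of [I] at the perturbed zeros *)

(** Summing the absolute values of the equations bounds [|e| * S] by [m%:R * eta * S], where [S] is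
    the sum of the [|G j|]; hence [S = 0]. *)
Lemma small_linear_system (R : realType) (m : nat) (G : 'I_m -> R)
    (M : 'I_m -> 'I_m -> R) (e eta : R) :
  (forall j, e * G j = \sum_k M j k * G k) ->
  (forall j k, `|M j k| <= eta) -> m%:R * eta < `|e| -> forall j, G j = 0.
Proof.
move=> eG Meta lt_e; pose S := \sum_j `|G j|.
have S0 : 0 <= S by apply: sumr_ge0.
have le_S : `|e| * S <= m%:R * eta * S.
  rewrite mulr_sumr; apply: (@le_trans _ _ (\sum_(j < m) eta * S)).
    apply: ler_sum => j _; rewrite -normrM eG mulr_sumr.
    apply: le_trans (ler_norm_sum _ _ _) _; apply: ler_sum => k _.
    by rewrite normrM ler_wpM2r.
  by rewrite sumr_const card_ord -[_ *+ m]mulr_natl mulrA.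
have {S0 le_S} S0 : S = 0.
  apply/eqP; rewrite eq_le S0 andbT leNgt; apply/negP => Sgt.
  by move: le_S; rewrite ler_pM2r // leNgt lt_e.
move=> j; apply/eqP; rewrite -normr_le0 -S0 /S (bigD1 j) //= lerDl.
by apply: sumr_ge0.
Qed.

Theorem lemma2p6 (R : realType) (n : nat) (I : ideal {mpoly R[n]})
    (w p : 'rV[R]_n)
    (p_in : p \in real_variety (in_ideal w I))
    (p_nonsing : nonsingular (in_ideal w I) p) :
  exists c0 : R, 0 < c0 /\ exists x : R -> 'rV[R]_n,
    (forall c : R, c0 < c -> scale_w w c (x c) \in real_variety I) /\
    x c @[c --> +oo] --> p.
Proof.
move/set_mem: p_in => Jp.
have [k [F [m [g [l [h [cf [b [[IF Ffree] gI [hl hp] hg blt]]]]]]]]] :=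
  initial_system Jp p_nonsing.
pose phi i c x := \sum_(a <- msupp (F i) | a \in msupp (F i))
  mcoeff a (F i) * c `^ (wdot w a - deg_w w (F i)) * eval_at x (mpolyX R a).
have phiE i c x : 0 < c ->
    phi i c x = c `^ (- deg_w w (F i)) * eval_at (scale_w w c x) (F i).
  by move=> c0; rewrite eval_scale // /phi -big_seq.
have phi0 i : phi i c p @[c --> +oo] --> 0.
  have <- : \sum_(a <- msupp (F i) | a \in msupp (F i))
      mcoeff a (in_w w (F i)) * eval_at p (mpolyX R a) = 0.
    transitivity (eval_at p (in_w w (F i))); last exact/Jp/in_w_in_ideal.
    rewrite [in RHS]/in_w [RHS]raddf_sum [RHS]big_mkcond -big_seq; apply: eq_bigr => a _.
    by rewrite in_wE mcoeff_wpart /=; case: ifP; rewrite ?mul0r // mevalZ.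
  apply: cvg_sumr => a af; apply: cvgM; last exact: cvg_cst.
  exact: coef_scale_cvg.
have [|x [phix xp]] := @perturbed_zero R n p k phi _ _ Ffree phi0.
  by move=> i; rewrite rowK; exact: hadamard_scale.
(* The error coefficients of [hg] after rescaling the values of the [g j]; they tend to 0 by
   [blt]. *)
pose M j j' c := c `^ (- (l + deg_w w (g j) - deg_w w (g j'))) *
  eval_at (scale_w w c (x c)) (b j j').
pose eta := `|eval_at p h| / (2 * m.+1%:R).
have eta0 : 0 < eta by rewrite divr_gt0 ?normr_gt0 // mulr_gt0.
have Mnear : \forall c \near +oo, forall jj, `|M jj.1 jj.2 c| <= eta.
  apply: filter_forall => -[j j']; apply: cvgr0_norm_le => //.
  exact: eval_scale_wltb_cvg (blt j j') xp.
have hnear : \forall c \near +oo, m%:R * eta < `|eval_at (x c) h|.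
  have hcvg : eval_at (x c) h @[c --> +oo] --> eval_at p h.
    apply: (@cvg_app _ _ _ _ _ _ x (fun y => eval_at y h) xp).
    exact: eval_continuous.
  apply: (cvgr_gt _ (cvg_norm hcvg)); rewrite /eta mulrCA gtr_pMr ?normr_gt0 //.
  rewrite ltr_pdivrMr ?mulr_gt0 // mul1r -natrM ltr_nat; lia.
have /pinftyP[c1 c1P] : \forall c \near +oo,
    [/\ 0 < c, forall i, phi i c (x c) = 0,
        forall jj, `|M jj.1 jj.2 c| <= eta & m%:R * eta < `|eval_at (x c) h|].
  near=> c; split; near: c => //; exact: nbhs_pinfty_gt.
exists (Num.max c1 1); split; first by rewrite lt_max ltr01 orbT.
exists x; split=> // c; rewrite gt_max => /andP[/c1P[c0 phic Mc hc] _].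
apply/mem_set => f /gI[e ->].
set P := scale_w w c (x c) in Mc phic *.
have FP i : eval_at P (F i) = 0.
  have /eqP := phic i; rewrite phiE // mulf_eq0 gt_eqF ?powR_gt0 //=.
  by move=> /eqP.
have powD r s : c `^ (r + s) = c `^ r * c `^ s.
  by rewrite powRD // (gt_eqF c0) implybT.
(* The identity [hg] is evaluated at [P], where the [F i] vanish, and multiplied by [c] to the power
   [- l - deg_w w (g j)]. Homogeneity of [h] turns its rescaled value at [P] into its value at
   [x c], which is bounded away from 0. *)
have gz j : c `^ (- deg_w w (g j)) * eval_at P (g j) = 0.
  move: j; apply: (small_linear_system (M := fun j j' => M j j' c) _ _ hc).
    move=> j; rewrite -(eval_scale_whomog (x c) c0 hl) -/P.
    have hgP : eval_at P h * eval_at P (g j) =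
        \sum_j' eval_at P (b j j') * eval_at P (g j').
      rewrite /eval_at -mevalM hg mevalD !raddf_sum /= big1 ?add0r => [|i _].
        by apply: eq_bigr => j' _; rewrite mevalM.
      by rewrite mevalM -/(eval_at P (F i)) FP mulr0.
    rewrite mulrACA hgP mulr_sumr; apply: eq_bigr => j' _.
    rewrite /M -/P [RHS]mulrACA; congr (_ * _); rewrite -!powD; congr (_ `^ _).
    by ring.
  by move=> j j'; exact: (Mc (j, j')).
rewrite /eval_at raddf_sum big1 // => j _; rewrite /= mevalM.
have /eqP := gz j; rewrite mulf_eq0 gt_eqF ?powR_gt0 //= => /eqP gj0.
by rewrite -/(eval_at P (g j)) gj0 mulr0.
Unshelve. all: by end_near. Qed.
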